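(* Let $r\ge 0$ be an integer, let $\lambda=(\lambda_0\ge\dots\ge\lambda_r)+\mathbb Z\cdot(1,\dots,1)\in\mathbb Z^{r+1}/\mathbb Z$ and let $g\in SL_{r+1}(\mathbb C)$. Then $$\bigwedge_{i=0}^{r} g^{\ell_i}=\chi_\lambda(g)\cdot\bigwedge_{i=0}^{r} g^{r-i},$$ where $\ell_i=\lambda_i+r-i$.
   Context: $\mathbb Z^{r+1}/\mathbb Z$ denotes the quotient of $\mathbb Z^{r+1}$ by the subgroup $\mathbb Z\cdot(1,\dots,1)$; it is the weight lattice of the maximal torus $H$ of unimodular diagonal matrices in $SL_{r+1}(\mathbb C)$, the class of $(\lambda_0,\dots,\lambda_r)$ corresponding to the character $\mathrm{diag}(z_0,\dots,z_r)\mapsto\prod_i z_i^{\lambda_i}$. The weight $\lambda$ is dominant when $\lambda_0\ge\dots\ge\lambda_r$, and then $\chi_\lambda:SL_{r+1}(\mathbb C)\to\mathbb C$ is the character of the irreducible representation of $SL_{r+1}(\mathbb C)$ with highest weight $\lambda$. The wedge product of elements $A_0,\dots,A_r$ of the vector space $M_{r+1}(\mathbb C)$ of $(r+1)\times(r+1)$ complex matrices is the antisymmetric tensor $\bigwedge_{i=0}^rA_i=\sum_{\sigma\in\mathfrak S_{r+1}}(-1)^\sigma A_{\sigma(0)}\otimes\dots\otimes A_{\sigma(r)}\in M_{r+1}(\mathbb C)^{\otimes(r+1)}$, where $(-1)^\sigma$ is the sign of $\sigma$. For $g\in SL_{r+1}(\mathbb C)$ and $\ell\in\mathbb Z^{r+1}$,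 the tensor $\bigwedge_{i=0}^r g^{\ell_i}$ depends only on the class of $\ell$ in $\mathbb Z^{r+1}/\mathbb Z$, so any representative of $\lambda$ may be used. *)

(* Defs.v *)
From HB Require Import structures.
From mathcomp Require Import all_boot all_order all_fingroup all_algebra.
From mathcomp Require Import reals complex mpoly.

Set Implicit Arguments.
Unset Strict Implicit.
Unset Printing Implicit Defensive.

Import Order.TTheory GRing.Theory Num.Theory.
Local Open Scope ring_scope.

(* M_n(C)^{(x) k} in coordinates: an element is given by its coefficients in
   the basis E_{p_0 q_0} (x) ... (x) E_{p_{k-1} q_{k-1}}, which is indexed by
   the functions e : i |-> (p_i, q_i). *)
Definition mxtensor (K : fieldType) (n k : nat) :=
  {ffun {ffun 'I_k -> 'I_n * 'I_n} -> K^o}.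

Definition pure_tensor (K : fieldType) (n k : nat) (A : 'I_k -> 'M[K]_n) :
    mxtensor K n k :=
  [ffun e : {ffun 'I_k -> 'I_n * 'I_n} => \prod_(i < k) A i (e i).1 (e i).2].

Definition wedge (K : fieldType) (n k : nat) (A : 'I_k -> 'M[K]_n) :
    mxtensor K n k :=
  \sum_(s : 'S_k) (-1) ^+ s *: pure_tensor (fun i => A (s i)).

Definition in_SL (K : fieldType) (n : nat) (g : 'M[K]_n) : Prop := \det g = 1.

(* A d-dimensional representation of SL_n as an algebraic group, acting on
   column vectors. The map rho is total on matrices, but only its values on
   SL_n are constrained, and used. Since \det = 1 on SL_n, regular functions
   on SL_n are the polynomials in the matrix entries. *)
Record SL_representation (K : fieldType) (n d : nat)
    (rho : 'M[K]_n -> 'M[K]_d) : Prop := {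
  SL_rep1 : rho 1%:M = 1%:M;
  SL_repM : forall g h : 'M[K]_n, in_SL g -> in_SL h ->
    rho (g *m h) = rho g *m rho h;
  SL_rep_regular : forall i j : 'I_d, exists p : {mpoly K[n * n]},
    forall g : 'M[K]_n, in_SL g -> rho g i j = p.@[fun k => mxvec g 0 k]
}.

Definition SL_irreducible (K : fieldType) (n d : nat)
    (rho : 'M[K]_n -> 'M[K]_d) : Prop :=
  (0 < d)%N /\
  forall U : {vspace 'cV[K]_d},
    (forall (g : 'M[K]_n) (v : 'cV[K]_d),
       in_SL g -> v \in U -> rho g *m v \in U) ->
    U = 0%VS \/ U = fullv.

Definition upper_unitriangular (K : fieldType) (n : nat) (u : 'M[K]_n) : Prop :=
  (forall i : 'I_n, u i i = 1) /\ (forall i j : 'I_n, (j < i)%N -> u i j = 0).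

(* Highest weights are taken with respect to the Borel subgroup of upper
   triangular matrices, for which lambda_0 >= ... >= lambda_r is dominance.
   Only the class of lambda modulo Z.(1, ..., 1) matters, as \prod_i z_i = 1. *)
Definition has_highest_weight (K : fieldType) (n d : nat)
    (rho : 'M[K]_n -> 'M[K]_d) (lambda : 'I_n -> int) : Prop :=
  exists v : 'cV[K]_d,
    [/\ v != 0,
        forall u : 'M[K]_n, upper_unitriangular u -> rho u *m v = v &
        forall z : 'rV[K]_n, \prod_(i < n) z 0 i = 1 ->
          rho (diag_mx z) *m v = (\prod_(i < n) z 0 i ^ lambda i) *: v].

(* chi is the character of the irreducible representation of SL_n with
   highest weight lambda; values of chi outside SL_n are irrelevant. *)
Definition is_irr_character (K : fieldType) (n : nat) (lambda : 'I_n -> int)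
    (chi : 'M[K]_n -> K) : Prop :=
  exists (d : nat) (rho : 'M[K]_n -> 'M[K]_d),
    [/\ SL_representation rho, SL_irreducible rho,
        has_highest_weight rho lambda &
        forall g : 'M[K]_n, in_SL g -> chi g = \tr (rho g)].

Definition dominant (n : nat) (lambda : 'I_n -> int) : Prop :=
  forall i j : 'I_n, (i <= j)%N -> lambda j <= lambda i.

(* Main.v *)
(* Weyl's character formula, proved with the Casimir operator and no complete
   reducibility.  Let V be irreducible with highest weight vector v.  Because
   U^- T U is dense in SL, the vectors rho(u) v with u lower unitriangular span
   V; the coefficients of the polynomial u |-> rho(u) v are therefore weight
   vectors spanning V, all of weight below lambda except the constant one.
   The Casimir operator is invariant, hence scalar, and its trace against
   rho(h), h in T, is computed from tr(rho(h) E_ij E_ji), which follows from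
   rho(h) E_ij = (h_i / h_j) E_ij rho(h) and [E_ij, E_ji] = E_ii - E_jj.  It
   says that Delta * chi (Delta the Vandermonde) is an eigenvector of the flat
   Laplacian \sum_i (x_i d/dx_i)^2 with eigenvalue |l|^2, l = lambda + rho.
   So every exponent nu of Delta * chi has norm |l|; a strictly decreasing one
   is below l in the dominance order, and <l - nu, l + nu> = 0 forces nu = l.
   By antisymmetry Delta * chi = \det (x_k ^ l_i).
   For a diagonalizable g, g^l = \sum_k z_k^l P_k turns the wedge of the
   g^(l_i) into \det (z_k ^ l_i) times the wedge of the P_k; the remaining g
   are reached along a curve in SL, diagonalizable for all but finitely many
   parameters. *)
Require Import Defs.
From HB Require Import structures.
From mathcomp Require Import all_boot all_order all_fingroup all_algebra.
From mathcomp Require Import reals complex mpoly.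
From mathcomp Require Import ring zify.

Set Implicit Arguments.
Unset Strict Implicit.
Unset Printing Implicit Defensive.

Import Order.TTheory GRing.Theory Num.Theory.
Local Open Scope ring_scope.

(** * Regular curves and their derivatives *)

(** [rho] is constrained on SL alone, so the derivative at 1 of the polynomials computing it is
    intrinsic only along curves that stay in SL. Derivatives are therefore taken algebraically along
    rational curves, and identities for the differential are checked on transvections and coroot
    tori, whose tangents span all matrices together with the identity. Letting the identity act by
    \sum_i lambda_i extends the action to all matrices; the Casimir is then the plain sum of E_ij
    E_ji, and E_ii acts on a vector of weight mu by mu_i. Characters are known only where \prod_i
    z_i = 1, whereas the Laplacian needs free variables. A common shift turns the weights into
    monomials of one degree, and dividing a point by an (r+1)-st root of the product of its
    coordinates carries the identities to all points with nonzero coordinates. The dominance order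
    enters only through pairings with strictly decreasing integer vectors, because the last step
    pairs with l + nu, which is such a vector. *)

Lemma poly_eq0_everywhere (K : numFieldType) (p : {poly K}) :
  (forall a, p.[a] = 0) -> p = 0.
Proof.
move=> p0; apply/eqP; apply/negPn/negP => /max_poly_roots pmax.
pose s := [seq (i%:R : K) | i <- iota 0 (size p)].
suff : (size s < size p)%N by rewrite size_map size_iota ltnn.
apply: pmax; first by apply/allP => x _; rewrite /root p0.
rewrite map_inj_uniq ?iota_uniq // => i j /eqP.
by rewrite eqr_nat => /eqP.
Qed.

Lemma poly_eq0_generic (K : numFieldType) (s p : {poly K}) :
  s != 0 -> (forall a, s.[a] != 0 -> p.[a] = 0) -> p = 0.
Proof.
move=> s0 p0; apply/eqP; have /eqP : s * p = 0.
  apply: poly_eq0_everywhere => a; rewrite hornerM.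
  by have [->|/p0 ->] := eqVneq s.[a] 0; rewrite ?mul0r ?mulr0.
by rewrite mulf_eq0 (negPf s0).
Qed.

Section RegularCurves.
Variables (K : numFieldType) (q : {poly K}).
Hypothesis q1 : q.[1] = 1.

(* [f] is a regular function on the open set [q <> 0] of the affine line,
   with derivative [d] at 1; the value of [f] where [q] vanishes is junk. *)
Definition regular_der (f : K -> K) (d : K) : Prop :=
  exists N (F : {poly K}),
    (forall a, q.[a] != 0 -> F.[a] = q.[a] ^+ N * f a) /\
    F^`().[1] = N%:R * q^`().[1] * f 1 + d.

Let q_neq0 : q != 0.
Proof.
by apply/eqP => q0; move: q1 => /eqP; rewrite q0 horner0 eq_sym oner_eq0.
Qed.

Let q1_neq0 : q.[1] != 0. Proof. by rewrite q1 oner_eq0. Qed.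

Let deriv_exp_at1 N : (q ^+ N)^`().[1] = N%:R * q^`().[1].
Proof. by rewrite deriv_exp hornerMn hornerM horner_exp q1 expr1n mulr1 mulr_natl. Qed.

Let at1 (f : K -> K) N (F : {poly K}) :
  (forall a, q.[a] != 0 -> F.[a] = q.[a] ^+ N * f a) -> F.[1] = f 1.
Proof. by move=> ->; rewrite // q1 expr1n mul1r. Qed.

Lemma regular_der_ext f g d :
  (forall a, q.[a] != 0 -> f a = g a) -> regular_der f d -> regular_der g d.
Proof.
move=> fg [N [F [Ff Fd]]]; exists N, F; split=> [a qa|]; first by rewrite Ff ?fg.
by rewrite Fd fg.
Qed.

Lemma regular_der_eq f d d' : d = d' -> regular_der f d -> regular_der f d'.
Proof. by move=> ->. Qed.

(** Cross-multiplying two presentations F / q^N and G / q^M gives a polynomial identity valid where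
    q does not vanish, hence everywhere. Its derivative at 1 compares d and d'. *)
Lemma regular_der_uniq f d d' : regular_der f d -> regular_der f d' -> d = d'.
Proof.
move=> [N [F [Ff Fd]]] [M [G [Gf Gd]]].
have: q ^+ M * F - q ^+ N * G = 0.
  apply: (poly_eq0_generic q_neq0) => a qa.
  by rewrite !hornerE Ff // Gf // mulrCA subrr.
move=> /(congr1 (fun p : {poly K} => p^`().[1])).
rewrite derivB !derivM deriv0 !hornerE !deriv_exp_at1 Fd Gd (at1 Ff) (at1 Gf).
rewrite q1 !expr1n => H; apply/eqP; rewrite -subr_eq0 -H; apply/eqP; ring.
Qed.

(** The density principle behind both passages to the limit: from the big cell to SL, and from
    diagonalizable matrices to all of SL. *)
Lemma regular_der_generic0 (s : {poly K}) f d : s != 0 ->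
  (forall a, q.[a] != 0 -> s.[a] != 0 -> f a = 0) -> regular_der f d -> f 1 = 0.
Proof.
move=> s0 f0 [N [F [Ff _]]]; rewrite -(at1 Ff).
suff -> : F = 0 by rewrite horner0.
have sq0 : s * q != 0 by rewrite mulf_neq0.
apply: (poly_eq0_generic sq0) => a; rewrite hornerM mulf_eq0 negb_or.
by case/andP => sa qa; rewrite Ff // f0 // mulr0.
Qed.

Lemma regular_der_poly (p : {poly K}) : regular_der (fun a => p.[a]) p^`().[1].
Proof. by exists 0%N, p; split=> [a _|]; rewrite ?expr0; ring. Qed.

Lemma regular_der_const c : regular_der (fun=> c) 0.
Proof.
apply: regular_der_ext (regular_der_eq _ (regular_der_poly c%:P)) => [a _|].
  by rewrite hornerC.
by rewrite derivC horner0.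
Qed.

Lemma regular_der_id : regular_der id 1.
Proof.
apply: regular_der_ext (regular_der_eq _ (regular_der_poly 'X)) => [a _|].
  by rewrite hornerX.
by rewrite derivX hornerC.
Qed.

Lemma regular_der_inv : regular_der (fun a => q.[a]^-1) (- q^`().[1]).
Proof.
exists 1%N, 1; split=> [a qa|]; first by rewrite hornerC expr1 divff.
by rewrite derivC horner0 q1 invr1 /=; ring.
Qed.

Lemma regular_derD f g d e :
  regular_der f d -> regular_der g e -> regular_der (fun a => f a + g a) (d + e).
Proof.
move=> [N [F [Ff Fd]]] [M [G [Gf Gd]]]; exists (N + M)%N, (q ^+ M * F + q ^+ N * G).
split=> [a qa|]; first by rewrite !hornerE Ff // Gf // exprD; ring.
rewrite derivD !derivM !hornerE !deriv_exp_at1 Fd Gd (at1 Ff) (at1 Gf).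
by rewrite q1 !expr1n natrD /=; ring.
Qed.

Lemma regular_derM f g d e : regular_der f d -> regular_der g e ->
  regular_der (fun a => f a * g a) (d * g 1 + f 1 * e).
Proof.
move=> [N [F [Ff Fd]]] [M [G [Gf Gd]]]; exists (N + M)%N, (F * G).
split=> [a qa|]; first by rewrite hornerM Ff // Gf // exprD; ring.
by rewrite derivM hornerD !hornerM Fd Gd (at1 Ff) (at1 Gf) natrD /=; ring.
Qed.

Lemma regular_der_scale c f d :
  regular_der f d -> regular_der (fun a => c * f a) (c * d).
Proof.
by move=> fd; apply: regular_der_eq (regular_derM (regular_der_const c) fd); ring.
Qed.

Lemma regular_der_sum (I : Type) (s : seq I) (P : pred I) (f : I -> K -> K) d :
  (forall i, P i -> regular_der (f i) (d i)) ->
  regular_der (fun a => \sum_(i <- s | P i) f i a) (\sum_(i <- s | P i) d i).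
Proof.
move=> fd; elim: s => [|i s IH].
  apply: regular_der_ext (regular_der_eq _ (regular_der_const 0)) => [a _|].
    by rewrite big_nil.
  by rewrite big_nil.
rewrite big_cons; case: ifP => Pi.
  apply: regular_der_ext (regular_derD (fd _ Pi) IH) => a _.
  by rewrite big_cons Pi.
by apply: regular_der_ext IH => a _; rewrite big_cons Pi.
Qed.

Lemma regular_der_prod (I : Type) (s : seq I) (P : pred I) (f : I -> K -> K) :
  (forall i, P i -> exists d, regular_der (f i) d) ->
  exists d, regular_der (fun a => \prod_(i <- s | P i) f i a) d.
Proof.
move=> fd; elim: s => [|i s [d IH]].
  by exists 0; apply: regular_der_ext (regular_der_const 1) => a _; rewrite big_nil.
have [Pi|/negPf Pi] := boolP (P i).
  by have [e fi] := fd _ Pi; eexists; apply: regular_der_ext (regular_derM fi IH) => a _; rewrite big_cons Pi.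
by exists d; apply: regular_der_ext IH => a _; rewrite big_cons Pi.
Qed.

Lemma regular_der_meval n (p : {mpoly K[n]}) (x : K -> 'I_n -> K) (dx : 'I_n -> K) :
  (forall k, regular_der (fun a => x a k) (dx k)) ->
  regular_der (fun a => p.@[x a]) (\sum_k (p^`M(k)).@[x 1] * dx k).
Proof.
move=> xd; elim/mpolyind: p => [|c m p _ _ IH].
  apply: regular_der_ext (regular_der_eq _ (regular_der_const 0)) => [a _|].
    by rewrite meval0.
  by rewrite big1 // => k _; rewrite mderiv0 meval0 mul0r.
have monom : regular_der (fun a => ('X_[m] : {mpoly K[n]}).@[x a])
    (\sum_k (('X_[m] : {mpoly K[n]})^`M(k)).@[x 1] * dx k).
  have cst1 : regular_der (fun a => (1 : {mpoly K[n]}).@[x a])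
      (\sum_k ((1 : {mpoly K[n]})^`M(k)).@[x 1] * dx k).
    apply: regular_der_ext (regular_der_eq _ (regular_der_const 1)) => [a _|].
      by rewrite meval1.
    by rewrite big1 // => k _; rewrite mderivC meval0 mul0r.
  have prodr (p1 p2 : {mpoly K[n]}) :
      regular_der (fun a => p1.@[x a]) (\sum_k (p1^`M(k)).@[x 1] * dx k) ->
      regular_der (fun a => p2.@[x a]) (\sum_k (p2^`M(k)).@[x 1] * dx k) ->
      regular_der (fun a => (p1 * p2).@[x a]) (\sum_k ((p1 * p2)^`M(k)).@[x 1] * dx k).
    move=> d1 d2.
    apply: regular_der_ext (regular_der_eq _ (regular_derM d1 d2)) => [a _|].
      by rewrite mevalM.
    rewrite mulr_suml mulr_sumr -big_split /=; apply: eq_bigr => k _.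
    by rewrite mderivM mevalD !mevalM; ring.
  rewrite mpolyXE_id; elim/big_ind: _ => // i _.
  elim: (m i) => [|N IHN]; first by rewrite expr0.
  rewrite exprS; apply: prodr => //.
  apply: regular_der_ext (regular_der_eq _ (xd i)) => [a _|].
    by rewrite mevalXU.
  rewrite (bigD1 i) //= big1 => [|k ki].
    by rewrite mderivX mnm1E eqxx scale1r mevalX big1 ?mul1r ?addr0 // => j _;
       rewrite mnmBE subnn.
  by rewrite mderivX mnm1E eq_sym (negPf ki) scale0r meval0 mul0r.
apply: regular_der_ext (regular_der_eq _ (regular_derD (regular_der_scale c monom) IH)).
  by move=> a _; rewrite mevalD mevalZ.
rewrite mulr_sumr -big_split /=; apply: eq_bigr => k _.
by rewrite mderivD mderivZ mevalD mevalZ mulrDl mulrA.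
Qed.

Definition regular_mxder m n (A : K -> 'M[K]_(m, n)) (D : 'M[K]_(m, n)) : Prop :=
  forall i j, regular_der (fun a => A a i j) (D i j).

Lemma regular_mxder_ext m n (A B : K -> 'M[K]_(m, n)) D :
  (forall a, q.[a] != 0 -> A a = B a) -> regular_mxder A D -> regular_mxder B D.
Proof.
by move=> AB AD i j; apply: regular_der_ext (AD i j) => a qa; rewrite AB.
Qed.

Lemma regular_mxder_eq m n (A : K -> 'M[K]_(m, n)) D D' :
  D = D' -> regular_mxder A D -> regular_mxder A D'.
Proof. by move=> ->. Qed.

Lemma regular_mxder_uniq m n (A : K -> 'M[K]_(m, n)) D D' :
  regular_mxder A D -> regular_mxder A D' -> D = D'.
Proof.
by move=> AD AD'; apply/matrixP => i j; apply: regular_der_uniq (AD i j) (AD' i j).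
Qed.

Lemma regular_mxder_const m n (A : 'M[K]_(m, n)) : regular_mxder (fun=> A) 0.
Proof. by move=> i j; rewrite mxE; apply: regular_der_const. Qed.

Lemma regular_mxderD m n (A B : K -> 'M[K]_(m, n)) D E :
  regular_mxder A D -> regular_mxder B E ->
  regular_mxder (fun a => A a + B a) (D + E).
Proof.
move=> AD BE i j; rewrite mxE; apply: regular_der_ext (regular_derD (AD i j) (BE i j)).
by move=> a _; rewrite mxE.
Qed.

Lemma regular_mxderZ m n f d (A : K -> 'M[K]_(m, n)) D :
  regular_der f d -> regular_mxder A D ->
  regular_mxder (fun a => f a *: A a) (d *: A 1 + f 1 *: D).
Proof.
move=> fd AD i j.
apply: regular_der_ext (regular_der_eq _ (regular_derM fd (AD i j))) => [a _|].
  by rewrite mxE.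
by rewrite !mxE.
Qed.

Lemma regular_mxderM m n p (A : K -> 'M[K]_(m, n)) (B : K -> 'M[K]_(n, p)) D E :
  regular_mxder A D -> regular_mxder B E ->
  regular_mxder (fun a => A a *m B a) (D *m B 1 + A 1 *m E).
Proof.
move=> AD BE i j.
apply: (@regular_der_ext (fun a => \sum_k A a i k * B a k j)) => [a _|].
  by rewrite mxE.
rewrite !mxE -big_split /=.
by apply: regular_der_sum => k _; apply: regular_derM.
Qed.

Lemma regular_mxder_mulmx m n p s (L : 'M[K]_(m, n)) (A : K -> 'M[K]_(n, p)) 
    (R : 'M[K]_(p, s)) D :
  regular_mxder A D -> regular_mxder (fun a => L *m A a *m R) (L *m D *m R).
Proof.
move=> AD; have LA := regular_mxderM (regular_mxder_const L) AD.
apply: regular_mxder_eq (regular_mxderM LA (regular_mxder_const R)).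
by rewrite mul0mx add0r mulmx0 addr0.
Qed.

End RegularCurves.

(** * Zeros of polynomials and the big cell *)

(** Independence of characters, by Artin's argument: if m and m0 differ at i, doubling x_i and
    subtracting 2^(m0 i) times the original relation removes m0 and multiplies the coefficient of m
    by a nonzero number. Nonzero coordinates suffice because doubling preserves them. *)
Lemma monomials_free (K : numFieldType) n (s : seq 'X_{1..n}) (c : 'X_{1..n} -> K) :
  uniq s ->
  (forall x : 'I_n -> K, (forall i, x i != 0) ->
     \sum_(m <- s) c m * \prod_i x i ^+ m i = 0) ->
  forall m, m \in s -> c m = 0.
Proof.
elim: s c => [//|m0 s IH] c /= /andP[m0s us] c0.
have cs m : m \in s -> c m = 0.
  move=> ms; have /existsP[i mi] : [exists i, m i != m0 i].
    apply: contraNT m0s => /existsPn mm0; suff -> : m0 = m by [].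
    by apply/mnmP => i; apply/esym/eqP; rewrite -[_ == _]negbK mm0.
  have diff_neq0 : (2%:R ^+ m i - 2%:R ^+ m0 i : K) != 0.
    by rewrite subr_eq0 -!natrX eqr_nat eqn_exp2l.
  have y0 (j : 'I_n) : (if j == i then 2%:R else 1 : K) != 0.
    by case: ifP => _; rewrite ?oner_eq0 // pnatr_eq0.
  have ym (m' : 'X_{1..n}) x : \prod_j (x j * if j == i then 2%:R else 1 : K) ^+ m' j
      = 2%:R ^+ m' i * \prod_j x j ^+ m' j.
    rewrite (bigD1 i) //= [in RHS](bigD1 i) //= eqxx exprMn.
    rewrite (eq_bigr (fun j => x j ^+ m' j)) => [|j /negPf -> //]; first by ring.
    by rewrite mulr1.
  have := IH (fun m => c m * (2%:R ^+ m i - 2%:R ^+ m0 i)) us _ m ms.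
  move=> /(_ _)/eqP; rewrite mulf_eq0 (negPf diff_neq0) orbF => H.
  apply/eqP/H => x x0.
  have e1 : 2%:R ^+ m0 i * (c m0 * \prod_j x j ^+ m0 j) +
      \sum_(m <- s) 2%:R ^+ m i * (c m * \prod_j x j ^+ m j) = 0.
    rewrite -[RHS](c0 (fun j => x j * if j == i then 2%:R else 1)) => [|j]; last first.
      by rewrite mulf_neq0.
    rewrite big_cons ym mulrCA; congr (_ + _).
    by apply: eq_bigr => m' _; rewrite ym mulrCA.
  have /eqP := c0 x x0; rewrite big_cons addrC addr_eq0 => /eqP e2.
  transitivity (\sum_(m <- s) 2%:R ^+ m i * (c m * \prod_j x j ^+ m j)
    - 2%:R ^+ m0 i * \sum_(m <- s) (c m * \prod_j x j ^+ m j)).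
    by rewrite mulr_sumr -sumrB; apply: eq_bigr => m' _; ring.
  by rewrite e2 -[RHS]e1; ring.
move=> m; rewrite inE => /predU1P[->|ms]; last exact: cs ms.
have := c0 (fun=> 1) (fun=> oner_neq0 _).
rewrite big_cons [X in _ + X]big_seq [X in _ + X]big1 => [|m1 /cs ->].
  by rewrite big1 ?mulr1 ?addr0 // => i _; rewrite expr1n.
by rewrite mul0r.
Qed.

Lemma mpoly_eq0_nonzero (K : numFieldType) n (p : {mpoly K[n]}) :
  (forall x : 'I_n -> K, (forall i, x i != 0) -> p.@[x] = 0) -> p = 0.
Proof.
move=> p0; apply/mpolyP => m; rewrite mcoeff0.
have [/memN_msupp_eq0 //|mp] := boolP (m \notin msupp p).
apply: (@monomials_free _ _ (msupp p) (fun m => p@_m)) => [|x x0|].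
- exact: msupp_uniq.
- by rewrite -mevalE p0.
- by rewrite negbK in mp.
Qed.

(** Gaussian elimination without pivoting. At t = 0 the matrix is triangular with nonzero diagonal,
    so no pivot is the zero polynomial; [s] collects the pivots that must not vanish at t. *)
Lemma lu_generic (K : fieldType) n (A : 'M[{poly K}]_n) :
  (forall i j : 'I_n, (j < i)%N -> (A i j).[0] = 0) ->
  (forall i, (A i i).[0] != 0) ->
  exists2 s : {poly K}, s != 0 & forall t, s.[t] != 0 ->
    exists L U : 'M[K]_n,
      [/\ is_trig_mx L, forall i, L i i = 1, is_trig_mx U^T
        & map_mx (horner^~ t) A = L *m U].
Proof.
elim: n A => [|n IH] A low diag.
  exists 1; first exact: oner_neq0.
  move=> t _; exists 0, 0; split; try by apply/is_trig_mxP => -[].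
  - by case.
  - by apply/matrixP => -[].
pose a := A ord0 ord0.
(* The Schur complement multiplied by the pivot [a], so that its entries remain polynomials; the
   factor is undone by [a.[t]^-1 *: U] below. *)
pose S := \matrix_(i, j) (a * A (lift ord0 i) (lift ord0 j) -
  A (lift ord0 i) ord0 * A ord0 (lift ord0 j)).
have a0 : a != 0 by apply: contraNneq (diag ord0) => a0; rewrite -/a a0 horner0.
have [i j ji|i|s s0 sLU] := IH S.
- have Aij0 : (A (lift ord0 i) (lift ord0 j)).[0] = 0 by rewrite low ?lift0.
  have Ai0 : (A (lift ord0 i) ord0).[0] = 0 by rewrite low ?lift0.
  by rewrite mxE hornerD hornerN !hornerM Aij0 Ai0 mulr0 mul0r subr0.
- have Ai0 : (A (lift ord0 i) ord0).[0] = 0 by rewrite low ?lift0.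
  rewrite mxE hornerD hornerN !hornerM Ai0 mul0r subr0.
  by rewrite mulf_neq0 ?diag.
exists (a * s) => [|t]; first by rewrite mulf_neq0.
rewrite hornerM mulf_eq0 negb_or => /andP[at0 /sLU[L [U [Ltrig Ldiag Utrig LU]]]].
exists (@block_mx _ 1 n 1 n 1%:M 0 (\col_i ((A (lift ord0 i) ord0).[t] / a.[t])) L).
exists (@block_mx _ 1 n 1 n a.[t]%:M (\row_j (A ord0 (lift ord0 j)).[t]) 0 (a.[t]^-1 *: U)).
have l0 : ord0 = @lshift 1 n ord0 by exact: val_inj.
split.
- rewrite (@is_trig_block_mx _ 1 n 1 n) // eqxx Ltrig scalar_mx_is_trig //.
- move=> i; case: (unliftP ord0 i) => [j|] ->.
    by rewrite -(rshift1 j) (@block_mxEdr _ 1 n 1 n) Ldiag.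
  by rewrite l0 (@block_mxEul _ 1 n 1 n) mxE.
- rewrite (@tr_block_mx _ 1 n 1 n) (@is_trig_block_mx _ 1 n 1 n) // trmx0 eqxx tr_scalar_mx scalar_mx_is_trig //=.
  by apply/is_trig_mxP => i j ij; rewrite !mxE; move/is_trig_mxP: Utrig => /(_ i j ij); rewrite mxE => ->; rewrite mulr0.
rewrite (@mulmx_block _ 1 n 1 n 1 n) !mul1mx !mul0mx !mulmx0 !addr0.
apply/matrixP => i j; rewrite mxE.
case: (unliftP ord0 i) (unliftP ord0 j) => [i'|] -> [j'|] ->.
- rewrite -(rshift1 i') -(rshift1 j') (@block_mxEdr _ 1 n 1 n) !rshift1 -scalemxAr -LU !mxE big_ord1 !mxE.
  by rewrite hornerD hornerN !hornerM; field.
- rewrite -(rshift1 i') l0 (@block_mxEdl _ 1 n 1 n) rshift1 -!l0 !mxE big_ord1 !mxE.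
  by rewrite mulfVK.
- by rewrite -(rshift1 j') l0 (@block_mxEur _ 1 n 1 n) rshift1 -!l0 !mxE.
by rewrite l0 (@block_mxEul _ 1 n 1 n) -!l0 !mxE.
Qed.

(** * The Casimir tensor and curves in SL *)

Lemma mul_mx_delta (R : pzSemiRingType) m n p (A : 'M[R]_(m, n)) i (j : 'I_p) :
  A *m delta_mx i j = \sum_k A k i *: delta_mx k j.
Proof.
apply/matrixP => a b; rewrite mxE summxE (bigD1 i) //= big1 => [|c ci].
  rewrite mxE eqxx addr0 (bigD1 a) //= big1 ?addr0 => [|c ca]; first by rewrite !mxE eqxx.
  by rewrite !mxE eq_sym (negPf ca) mulr0.
by rewrite mxE (negPf ci) mulr0.
Qed.

Lemma mul_delta_mx_r (R : comPzSemiRingType) m n p (A : 'M[R]_(n, p)) (i : 'I_m) j :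
  delta_mx i j *m A = \sum_k A j k *: delta_mx i k.
Proof.
apply: trmx_inj; rewrite trmx_mul trmx_delta mul_mx_delta linear_sum.
by apply: eq_bigr => k _; rewrite linearZ /= trmx_delta mxE.
Qed.

(** The families E_ij and E_ji are dual for the trace form, so a left factor on one leg of the
    tensor moves to the right of the other leg. With its mirror image this gives invariance under
    conjugation. *)
Lemma casimir_mulmx_l (K : fieldType) n d (f h : {linear 'M[K]_n -> 'M[K]_d}) (g : 'M[K]_n) :
  \sum_i \sum_j f (g *m delta_mx i j) *m h (delta_mx j i) =
  \sum_i \sum_j f (delta_mx i j) *m h (delta_mx j i *m g).
Proof.
under eq_bigr => i _ do under eq_bigr => j _ do
  rewrite mul_mx_delta linear_sum mulmx_suml.
under [RHS]eq_bigr => i _ do under eq_bigr => j _ do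
  rewrite mul_delta_mx_r linear_sum mulmx_sumr.
under eq_bigr => i _ do rewrite exchange_big /=.
under [RHS]eq_bigr => i _ do rewrite exchange_big /=.
rewrite exchange_big /=; apply: eq_bigr => i _; apply: eq_bigr => j _.
by apply: eq_bigr => k _; rewrite !linearZ /= -scalemxAl.
Qed.

Lemma casimir_mulmx_r (K : fieldType) n d (f h : {linear 'M[K]_n -> 'M[K]_d}) (g : 'M[K]_n) :
  \sum_i \sum_j f (delta_mx i j *m g) *m h (delta_mx j i) =
  \sum_i \sum_j f (delta_mx i j) *m h (g *m delta_mx j i).
Proof.
under eq_bigr => i _ do under eq_bigr => j _ do
  rewrite mul_delta_mx_r linear_sum mulmx_suml.
under [RHS]eq_bigr => i _ do under eq_bigr => j _ do
  rewrite mul_mx_delta linear_sum mulmx_sumr.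
apply: eq_bigr => i _; rewrite exchange_big /=; apply: eq_bigr => j _.
by apply: eq_bigr => k _; rewrite !linearZ /= -scalemxAl.
Qed.

Lemma casimir_conj (K : fieldType) n d (f : {linear 'M[K]_n -> 'M[K]_d}) (g h : 'M[K]_n) :
  g *m h = 1%:M ->
  \sum_i \sum_j f (g *m delta_mx i j *m h) *m f (g *m delta_mx j i *m h) =
  \sum_i \sum_j f (delta_mx i j) *m f (delta_mx j i).
Proof.
move=> gh.
have := casimir_mulmx_l (f \o mulmxr h) (f \o mulmxr h \o mulmx g) g => /= ->.
under eq_bigr => i _ do under eq_bigr => j _ do rewrite mulmxA -[_ *m g *m h]mulmxA gh mulmx1.
have := casimir_mulmx_r f (f \o mulmx g) h => /= ->.
by apply: eq_bigr => i _; apply: eq_bigr => j _; rewrite mulmxA gh mul1mx.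
Qed.

(** The test directions are the tangents of the curves in SL used below, together with the identity.
    Diagonal units are recovered from (r+1) E_ii = \sum_j (E_ii - E_jj) + 1, which is where
    characteristic 0 enters. *)
Lemma linear_mx_eq0 (K : numFieldType) r (V : lmodType K) (f : {linear 'M[K]_r.+1 -> V}) :
  (forall i j, i != j -> f (delta_mx i j) = 0) ->
  (forall i j, i != j -> f (delta_mx i i - delta_mx j j) = 0) -> f 1%:M = 0 ->
  forall X, f X = 0.
Proof.
move=> fij fii f1 X; rewrite (matrix_sum_delta X) !linear_sum big1 // => i _.
rewrite linear_sum big1 // => j _; rewrite linearZ /=.
have [<-|/fij ->] := eqVneq i j; last by rewrite scaler0.
suff: r.+1%:R *: f (delta_mx i i) = 0.
  by move/eqP; rewrite scaler_eq0 pnatr_eq0 => /eqP ->; rewrite scaler0.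
have <- : \sum_j f (delta_mx i i - delta_mx j j) + f 1%:M = 0.
  rewrite f1 addr0 big1 // => k _; have [->|/fii //] := eqVneq i k.
  by rewrite subrr linear0.
under eq_bigr do rewrite linearB.
rewrite sumrB sumr_const card_ord /= scaler_nat -linear_sum.
suff -> : \sum_(k < r.+1) delta_mx k k = 1%:M :> 'M[K]_r.+1 by rewrite subrK.
apply/matrixP => a b; rewrite summxE (bigD1 a) //= big1 ?addr0 => [|k ka].
  by rewrite !mxE eqxx eq_sym.
by rewrite !mxE eq_sym (negPf ka).
Qed.

(** * Curves in SL tangent to root vectors and coroots *)

Section Elementary.
Variables (K : numFieldType) (r : nat).
Implicit Types (i j : 'I_r.+1).

Definition transvection i j (s : K) : 'M[K]_r.+1 := 1%:M + s *: delta_mx i j.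

Lemma transvection_SL i j s : i != j -> in_SL (transvection i j s).
Proof.
have low (k l : 'I_r.+1) t : (l < k)%N -> in_SL (transvection k l t).
  move=> lk; rewrite /in_SL det_trig => [|].
    apply: big1 => m _; rewrite !mxE eqxx /=.
    suff -> : (m == k) && (m == l) = false by rewrite mulr0 addr0.
    by apply/negP => /andP[/eqP-> /eqP kl]; rewrite kl ltnn in lk.
  apply/is_trig_mxP => a b ab; rewrite !mxE -val_eqE ltn_eqF //= add0r.
  suff -> : (a == k) && (b == l) = false by rewrite mulr0.
  by apply/negP => /andP[/eqP ak /eqP bl]; rewrite ak bl ltnNge ltnW in ab.
rewrite neq_ltn => /orP[ij|ji]; last exact: low.
suff -> : transvection i j s = (transvection j i s)^T by rewrite /in_SL det_tr; apply: low.
by rewrite linearD linearZ /= trmx1 trmx_delta.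
Qed.

(** A coroot one-parameter subgroup. It is multiplicative in [a] and passes through the identity at
    a = 1, which is why all derivatives are taken at 1; transvections are reparametrised by a - 1
    accordingly. *)
Definition torus_curve i j (a : K) : 'M[K]_r.+1 :=
  diag_mx (\row_k (if k == i then a else if k == j then a^-1 else 1)).

Lemma torus_curve_prod i j a : i != j -> a != 0 ->
  \prod_k (\row_k (if k == i then a else if k == j then a^-1 else 1) : 'rV[K]_r.+1) 0 k = 1.
Proof.
move=> ij a0; rewrite (bigD1 i) //= (bigD1 j) 1?eq_sym //= !mxE !eqxx.
rewrite eq_sym (negPf ij) big1 ?mulr1 ?divff // => k /andP[ki kj].
by rewrite mxE (negPf ki) (negPf kj).
Qed.

Lemma regular_transvection i j :
  regular_mxder 'X (fun a => transvection i j (a - 1)) (delta_mx i j).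
Proof.
move=> k l; have X1 := hornerX (1 : K); have aX : regular_der 'X (fun a : K => a - 1) 1.
  have := regular_derD X1 (regular_der_id X1) (regular_der_const X1 (- 1)).
  by rewrite addr0.
have := regular_derD X1 (regular_der_const X1 ((1%:M : 'M[K]_r.+1) k l))
  (regular_der_scale X1 ((delta_mx i j : 'M[K]_r.+1) k l) aX).
rewrite add0r mulr1; apply: regular_der_ext => [|a _]; first exact: X1.
by rewrite !mxE mulrC.
Qed.

Lemma regular_torus_curve i j : i != j ->
  regular_mxder 'X (torus_curve i j) (delta_mx i i - delta_mx j j).
Proof.
move=> ij k l; have X1 := hornerX (1 : K).
have [<-{l}|kl] := eqVneq k l; last first.
  apply: regular_der_ext (regular_der_eq _ (regular_der_const X1 0)) => // [a _|].
    by rewrite !mxE (negPf kl).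
  have E a : (k == a) && (l == a) = false.
    by apply/negP => /andP[/eqP ka /eqP la]; rewrite ka la eqxx in kl.
  by rewrite !mxE !E subrr.
have [ki|ki] := eqVneq k i; last have [kj|kj] := eqVneq k j.
- apply: regular_der_ext (regular_der_eq _ (regular_der_id X1)) => // [a _|].
    by rewrite !mxE eqxx ki eqxx.
  by rewrite !mxE ki eqxx (negPf ij) subr0.
- apply: regular_der_ext (regular_der_eq _ (regular_der_inv X1)) => // [a _|].
    by rewrite !mxE eqxx kj eq_sym (negPf ij) eqxx hornerX.
  by rewrite !mxE kj eqxx eq_sym (negPf ij) derivX hornerC sub0r.
apply: regular_der_ext (regular_der_eq _ (regular_der_const X1 1)) => // [a _|].
  by rewrite !mxE eqxx (negPf ki) (negPf kj).
by rewrite !mxE (negPf ki) (negPf kj) subrr.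
Qed.

End Elementary.

(** * The differential of a representation *)

Lemma in_SL1 (K : fieldType) n : in_SL (1%:M : 'M[K]_n).
Proof. exact: det1. Qed.

Lemma in_SLM (K : fieldType) n (g h : 'M[K]_n) : in_SL g -> in_SL h -> in_SL (g *m h).
Proof. by rewrite /in_SL det_mulmx => -> ->; rewrite mulr1. Qed.

Lemma in_SL_unit (K : fieldType) n (g : 'M[K]_n) : in_SL g -> g \in unitmx.
Proof. by rewrite /in_SL unitmxE => ->; rewrite unitr1. Qed.

Lemma in_SLV (K : fieldType) n (g : 'M[K]_n) : in_SL g -> in_SL (invmx g).
Proof. by rewrite /in_SL det_inv => ->; rewrite invr1. Qed.

Section Differential.
Variables (K : numFieldType) (r d : nat).
Variable P : 'I_d -> 'I_d -> {mpoly K[r.+1 * r.+1]}.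

(** The polynomials [P] agree with [rho] only on SL, so this value is determined by [rho] for X
    tangent to SL, that is, of trace 0; in other directions it depends on the choice of [P]. *)
Definition differential (X : 'M[K]_r.+1) : 'M[K]_d :=
  \matrix_(i, j) \sum_k (P i j)^`M(k).@[fun l => mxvec 1%:M 0 l] * mxvec X 0 k.

Fact differential_is_linear : linear differential.
Proof.
move=> a X Y; apply/matrixP => i j; rewrite !mxE mulr_sumr -big_split /=.
by apply: eq_bigr => k _; rewrite linearP /= !mxE; ring.
Qed.

HB.instance Definition _ := GRing.isLinear.Build K 'M[K]_r.+1 'M[K]_d *:%R
  differential differential_is_linear.

(* Extends the differential at 1 of a representation of SL to all matrices by
   letting the identity act as [s]; this gives the action of gl on the
   representation of GL in which the scalars have degree [s]. *)
Definition gl_action (s : K) (X : 'M[K]_r.+1) : 'M[K]_d :=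
  differential X + (\tr X / r.+1%:R) *: (s%:M - differential 1%:M).

Fact gl_action_is_linear s : linear (gl_action s).
Proof.
move=> a X Y; rewrite /gl_action; set W := _ - _.
rewrite [differential _]linearP mxtraceD mxtraceZ [a *: (_ + _)]scalerDr scalerA.
by rewrite addrACA -scalerDl; congr (_ + _ *: _); ring.
Qed.

HB.instance Definition _ s := GRing.isLinear.Build K 'M[K]_r.+1 'M[K]_d *:%R
  (gl_action s) (gl_action_is_linear s).

Lemma gl_action1 s : gl_action s 1%:M = s%:M.
Proof.
rewrite /gl_action mxtrace1 divff ?pnatr_eq0 // scale1r addrC subrK //.
Qed.

Lemma gl_action_tr0 s X : \tr X = 0 -> gl_action s X = differential X.
Proof. by rewrite /gl_action => ->; rewrite mul0r scale0r addr0. Qed.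

Lemma mxtrace_delta_neq (i j : 'I_r.+1) : i != j -> \tr (delta_mx i j : 'M[K]_r.+1) = 0.
Proof.
move=> ij; apply: big1 => k _; rewrite mxE.
by case: eqVneq => [->|] //=; rewrite (negPf ij).
Qed.

Lemma mxtrace_delta_eq (i : 'I_r.+1) : \tr (delta_mx i i : 'M[K]_r.+1) = 1.
Proof.
rewrite /mxtrace (bigD1 i) //= big1 ?addr0 ?mxE ?eqxx // => k ki.
by rewrite mxE (negPf ki).
Qed.

Definition casimir s : 'M[K]_d :=
  \sum_i \sum_j gl_action s (delta_mx i j) *m gl_action s (delta_mx j i).

Variable rho : 'M[K]_r.+1 -> 'M[K]_d.
Hypothesis rho_rep : SL_representation rho.
Hypothesis rhoP : forall i j g, in_SL g -> rho g i j = (P i j).@[fun k => mxvec g 0 k].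

Lemma rep_regular_curve q (c : K -> 'M[K]_r.+1) X : q.[1] = 1 -> c 1 = 1%:M ->
  (forall a, q.[a] != 0 -> in_SL (c a)) ->
  regular_mxder q c X -> regular_mxder q (rho \o c) (differential X).
Proof.
move=> q1 c1 cSL cX i j; rewrite mxE -c1.
apply: (@regular_der_ext _ _ q1 (fun a => (P i j).@[fun k => mxvec (c a) 0 k])).
  by move=> a qa; rewrite /= rhoP //; apply: cSL.
apply: (@regular_der_meval _ _ q1 _ (P i j) (fun a k => mxvec (c a) 0 k)) => k.
case/mxvec_indexP: k => k l; rewrite mxvecE.
by apply: regular_der_ext (cX k l) => // a _; rewrite mxvecE.
Qed.

Lemma repV g : in_SL g -> rho g *m rho (invmx g) = 1%:M.
Proof.
move=> gSL; have [rho1 rhoM _] := rho_rep.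
by rewrite -rhoM ?mulmxV ?rho1 ?in_SL_unit //; apply: in_SLV.
Qed.

(** Differentiate rho (g c(a) g^-1) at a = 1 in two ways. The curve in SL with tangent X is what
    makes both derivatives meaningful. *)
Lemma differential_curve_conj q (c : K -> 'M[K]_r.+1) X g : q.[1] = 1 -> c 1 = 1%:M ->
  (forall a, q.[a] != 0 -> in_SL (c a)) -> regular_mxder q c X -> in_SL g ->
  rho g *m differential X = differential (g *m X *m invmx g) *m rho g.
Proof.
move=> q1 c1 cSL cX gSL; have [rho1 rhoM _] := rho_rep; have giSL := in_SLV gSL.
have rgV := repV gSL; have ug := in_SL_unit gSL.
suff <- : rho g *m differential X *m rho (invmx g) = differential (g *m X *m invmx g).
  by rewrite -!mulmxA (mulmx1C rgV) mulmx1.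
have d1 := regular_mxder_mulmx q1 (rho g) (rho (invmx g)) (rep_regular_curve q1 c1 cSL cX).
have d2 := regular_mxder_mulmx q1 g (invmx g) cX.
apply: (regular_mxder_uniq q1 d1).
apply: regular_mxder_ext (rep_regular_curve q1 _ _ d2) => //= [a qa||a qa].
- by have ca := cSL a qa; rewrite !rhoM //; apply: in_SLM.
- by rewrite c1 mulmx1 mulmxV.
- by have ca := cSL a qa; do 2!apply: in_SLM => //.
Qed.

Lemma transvection0 (i j : 'I_r.+1) : transvection i j (1 - 1) = 1%:M :> 'M[K]_r.+1.
Proof. by rewrite /transvection subrr scale0r addr0. Qed.

Lemma torus_curve1 (i j : 'I_r.+1) : torus_curve i j 1 = 1%:M :> 'M[K]_r.+1.
Proof.
rewrite /torus_curve -[RHS]diag_const_mx; congr diag_mx.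
by apply/rowP => k; rewrite !mxE invr1; case: ifP => //; case: ifP.
Qed.

Lemma torus_curve_SL (i j : 'I_r.+1) (a : K) : i != j -> a != 0 -> in_SL (torus_curve i j a).
Proof. by move=> ij a0; rewrite /in_SL det_diag torus_curve_prod. Qed.

(** The defect is linear in X, so [linear_mx_eq0] reduces the claim to tangents of curves in SL and
    to the identity, which acts by a scalar. *)
Lemma gl_action_conj s g X : in_SL g ->
  rho g *m gl_action s X = gl_action s (g *m X *m invmx g) *m rho g.
Proof.
move=> gSL; have gu := in_SL_unit gSL; apply/eqP; rewrite -subr_eq0; apply/eqP.
have traceJ Y : \tr (g *m Y *m invmx g) = \tr Y.
  by rewrite mxtrace_mulC mulmxA mulVmx // mul1mx.
pose f Y := rho g *m gl_action s Y - gl_action s (g *m Y *m invmx g) *m rho g.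
have flin : linear f.
  move=> a Y Z; rewrite /f.
  have -> : g *m (a *: Y + Z) *m invmx g = a *: (g *m Y *m invmx g) + g *m Z *m invmx g.
    by rewrite mulmxDr mulmxDl -scalemxAr -scalemxAl.
  rewrite !gl_action_is_linear mulmxDr mulmxDl -scalemxAr -scalemxAl.
  by rewrite opprD addrACA scalerBr.
pose fL : {linear 'M[K]_r.+1 -> 'M[K]_d} := HB.pack f (GRing.isLinear.Build _ _ _ _ f flin).
have f0 Y : \tr Y = 0 ->
    rho g *m differential Y = differential (g *m Y *m invmx g) *m rho g -> f Y = 0.
  by move=> trY e; rewrite /f !gl_action_tr0 ?traceJ // e subrr.
apply: (linear_mx_eq0 (f := fL)) => [i j ij|i j ij|] /=.
- apply: f0; first exact: mxtrace_delta_neq.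
  apply: (@differential_curve_conj 'X (fun a => transvection i j (a - 1)) _ g (hornerX 1)
    (transvection0 i j) _ (regular_transvection K i j)) => // a _.
  exact: transvection_SL.
- apply: f0; first by rewrite linearB /= !mxtrace_delta_eq subrr.
  apply: (differential_curve_conj (hornerX 1) (torus_curve1 i j) _ (regular_torus_curve K ij)) => // a.
  by rewrite hornerX; apply: torus_curve_SL.
by rewrite /f mulmx1 mulmxV // gl_action1 scalar_mxC subrr.
Qed.

Lemma casimir_comm s g : in_SL g -> rho g *m casimir s = casimir s *m rho g.
Proof.
move=> gSL; rewrite /casimir -[in RHS](casimir_conj (gl_action s) (mulmxV (in_SL_unit gSL))).
rewrite mulmx_sumr mulmx_suml; apply: eq_bigr => i _.
rewrite mulmx_sumr mulmx_suml; apply: eq_bigr => j _.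
by rewrite mulmxA gl_action_conj // -[LHS]mulmxA gl_action_conj // mulmxA.
Qed.

(** The bracket is obtained by differentiating the conjugation formula along t = 1 + (a - 1) e.
    Since e^2 = 0, the inverse of t is 1 - (a - 1) e and t f t^-1 = f + (a - 1)(ef - fe) - (a - 1)^2
    efe; the curve in [dY] is the image of this expansion. *)
Lemma gl_action_bracket s (i j : 'I_r.+1) : i != j ->
  gl_action s (delta_mx i j) *m gl_action s (delta_mx j i) -
  gl_action s (delta_mx j i) *m gl_action s (delta_mx i j) =
  gl_action s (delta_mx i i - delta_mx j j).
Proof.
move=> ij; have X1 := hornerX (1 : K); set e := delta_mx i j; set f := delta_mx j i.
have cSL a : ('X : {poly K}).[a] != 0 -> in_SL (transvection i j (a - 1)).
  by move=> _; apply: transvection_SL.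
have de := @rep_regular_curve 'X (fun a => transvection i j (a - 1)) _ X1 (transvection0 i j)
  cSL (regular_transvection K i j).
have dY : regular_mxder 'X
    (fun a => differential f + (a - 1) *: differential (e *m f - f *m e)
       + - (a - 1) ^+ 2 *: differential (e *m f *m e)) (differential (e *m f - f *m e)).
  have aX : regular_der 'X (fun a : K => a - 1) 1.
    have := regular_derD X1 (regular_der_id X1) (regular_der_const X1 (- 1)).
    by rewrite addr0.
  have aX2 : regular_der 'X (fun a : K => - (a - 1) ^+ 2) 0.
    have := regular_der_scale X1 (-1) (regular_derM X1 aX aX).
    by rewrite subrr mulr0 mul0r addr0 mulr0; apply: regular_der_ext => // a _; ring.
  have cst := regular_mxder_const X1.
  have := regular_mxderD X1 (regular_mxderD X1 (cst _ _ (differential f))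
    (regular_mxderZ X1 aX (cst _ _ (differential (e *m f - f *m e)))))
    (regular_mxderZ X1 aX2 (cst _ _ (differential (e *m f *m e)))).
  by rewrite !scaler0 scale0r !addr0 scale1r add0r.
have ee : e *m e = 0 by rewrite mul_delta_mx_0 // eq_sym.
have trE : \tr e = 0 by exact: mxtrace_delta_neq.
have trF : \tr f = 0 by apply: mxtrace_delta_neq; rewrite eq_sym.
have conjF (a : K) : a != 0 ->
  rho (transvection i j (a - 1)) *m differential f =
  (differential f + (a - 1) *: differential (e *m f - f *m e)
       + - (a - 1) ^+ 2 *: differential (e *m f *m e)) *m rho (transvection i j (a - 1)).
  move=> a0; set t := transvection _ _ _; have tSL : in_SL t by apply: transvection_SL.
  have := gl_action_conj s f tSL; rewrite !gl_action_tr0 //; last first.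
    by rewrite mxtrace_mulC mulmxA mulVmx ?mul1mx // in_SL_unit.
  move=> ->; rewrite -!linearZ -!linearD /=; congr (differential _ *m _).
  have tinv : t *m (1%:M - (a - 1) *: e) = 1%:M.
    rewrite /t /transvection mulmxDl mul1mx mulmxBr mulmx1 -scalemxAl -scalemxAr -/e ee.
    by rewrite !scaler0 subr0 subrK.
  have -> : invmx t = 1%:M - (a - 1) *: e.
    have := congr1 (mulmx (invmx t)) tinv.
    by rewrite mulmxA mulVmx ?in_SL_unit // mul1mx mulmx1.
  rewrite /t /transvection mulmxDl mul1mx mulmxBr mulmx1 !mulmxDl -!scalemxAl -!scalemxAr.
  rewrite -/e; move: (e *m f) (f *m e) => u v; move: (u *m e) => w.
  by apply/matrixP => k l; rewrite !mxE; ring.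
have ef : e *m f - f *m e = delta_mx i i - delta_mx j j by rewrite !mul_delta_mx.
rewrite -ef !gl_action_tr0 //; last by rewrite linearB /= [\tr (f *m e)]mxtrace_mulC subrr.
have d1 := regular_mxderM X1 de (regular_mxder_const X1 (differential f)).
have d2 := regular_mxderM X1 dY de.
have := regular_mxder_uniq X1 (regular_mxder_ext X1 _ d1) d2; rewrite /= transvection0.
have [rho1 _ _] := rho_rep; rewrite rho1 subrr scale0r expr0n oppr0 scale0r !addr0.
rewrite mulmx0 mulmx1 addr0 => -> => [|a]; first by rewrite addrK.
by rewrite hornerX => a0; rewrite conjF.
Qed.
End Differential.

(** * Weights of an irreducible representation *)

(** The substitute for Schur's lemma: a stable kernel containing one nonzero vector is everything.
    No eigenvalue has to be found, as the Casimir scalar is read off on a highest weight vector. *)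
Lemma irreducible_kernel (K : fieldType) n d (rho : 'M[K]_n -> 'M[K]_d) k
    (Z : 'M[K]_(k, d)) (v : 'cV[K]_d) :
  SL_irreducible rho -> v != 0 -> Z *m v = 0 ->
  (forall g (w : 'cV[K]_d), in_SL g -> Z *m w = 0 -> Z *m (rho g *m w) = 0) -> Z = 0.
Proof.
move=> [_ irr] v0 Zv Zinv.
have memU w : (w \in lker (linfun (mulmx Z : 'cV_d -> 'cV_k))) = (Z *m w == 0).
  by rewrite memv_ker lfunE.
have [g w gSL|U0|Ufull] := irr (lker (linfun (mulmx Z : 'cV_d -> 'cV_k))).
- by rewrite !memU => /eqP Zw; rewrite Zinv.
- by move: v0; rewrite -memv0 -U0 memU Zv eqxx.
apply/matrixP => i j; have := memvf (delta_mx j 0 : 'cV[K]_d).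
rewrite -Ufull memU => /eqP/matrixP/(_ i 0); rewrite !mxE (bigD1 j) //= big1 => [|l lj].
  by rewrite mxE !eqxx mulr1 addr0.
by rewrite mxE (negPf lj) mulr0.
Qed.

Lemma meval_superset (K : fieldType) n (p : {mpoly K[n]}) s x :
  uniq s -> {subset msupp p <= s} ->
  p.@[x] = \sum_(m <- s) p@_m * \prod_i x i ^+ m i.
Proof.
move=> us ps; rewrite mevalE.
rewrite (perm_big [seq m <- s | m \in msupp p]) /=; last first.
  apply: uniq_perm; rewrite ?msupp_uniq ?filter_uniq // => m.
  by rewrite mem_filter andb_idr //; apply: ps.
rewrite big_filter big_mkcond; apply: eq_bigr => m _.
by case: ifPn => // /memN_msupp_eq0 ->; rewrite mul0r.
Qed.

Lemma prod_mxvec (R : comPzSemiRingType) m n (F : 'I_(m * n) -> R) :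
  \prod_k F k = \prod_i \prod_j F (mxvec_index i j).
Proof.
rewrite pair_big (reindex _ (curry_mxvec_bij _ _)) /=.
by apply: eq_bigr => -[].
Qed.

Lemma unitriangular_SL (K : fieldType) n (u : 'M[K]_n) : upper_unitriangular u -> in_SL u.
Proof.
move=> [u1 u0]; rewrite /in_SL -det_tr det_trig; first by apply: big1 => i _; rewrite mxE u1.
by apply/is_trig_mxP => i j ij; rewrite mxE u0.
Qed.

Lemma exprz2_inj (K : numFieldType) : injective (fun a : int => 2%:R ^ a : K).
Proof.
move=> a b; wlog ab : a b / a <= b.
  by move=> H e; case: (leP a b) => [/H|/ltW/H e']; [exact | rewrite e'].
have [n ->] : exists n : nat, b = a + n%:Z by exists `|b - a|%N; lia.
rewrite expfzDr ?pnatr_eq0 // -[LHS]mulr1 => /mulfI; rewrite expfz_eq0 pnatr_eq0 andbF.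
move=> /(_ isT)/eqP; rewrite -[_ ^ n]natrX eq_sym pnatr_eq1 => /eqP n0.
suff -> : n = 0%N by rewrite addr0.
by case: n n0 => // n /eqP; rewrite expnS muln_eq1.
Qed.

(** * Weight vectors from the orbit of the highest weight vector under U^- *)

Section HighestWeight.
Variables (K : numFieldType) (r d : nat).
Variable rho : 'M[K]_r.+1 -> 'M[K]_d.
Variable P : 'I_d -> 'I_d -> {mpoly K[r.+1 * r.+1]}.
Hypothesis rho_rep : SL_representation rho.
Hypothesis rhoP : forall i j g, in_SL g -> rho g i j = (P i j).@[fun k => mxvec g 0 k].
Hypothesis rho_irr : SL_irreducible rho.
Variables (lambda : 'I_r.+1 -> int) (v : 'cV[K]_d).
Hypothesis v0 : v != 0.
Hypothesis v_unip : forall u, upper_unitriangular u -> rho u *m v = v.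
Hypothesis v_torus : forall z : 'rV[K]_r.+1, \prod_i z 0 i = 1 ->
  rho (diag_mx z) *m v = (\prod_i z 0 i ^ lambda i) *: v.

Let rhoM : forall g h, in_SL g -> in_SL h -> rho (g *m h) = rho g *m rho h.
Proof. by case: rho_rep. Qed.

Lemma rep_upper_triangular (B : 'M[K]_r.+1) : is_trig_mx B^T -> in_SL B ->
  exists c, rho B *m v = c *: v.
Proof.
move=> Btrig BSL; have prodB : \prod_i B i i = 1.
  by rewrite -[RHS]BSL -det_tr det_trig //; apply: eq_bigr => i _; rewrite mxE.
have B0 i : B i i != 0.
  by apply/eqP => Bi; move/eqP: prodB; rewrite (bigD1 i) //= Bi mul0r eq_sym oner_eq0.
pose z : 'rV[K]_r.+1 := \row_i B i i; pose u := \matrix_(i, j) (B i j / B i i).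
have zprod : \prod_i z 0 i = 1 by rewrite -[RHS]prodB; apply: eq_bigr => i _; rewrite mxE.
have uu : upper_unitriangular u.
  split=> [i|i j ij]; rewrite mxE ?divff //.
  by move/is_trig_mxP/(_ j i ij): Btrig; rewrite mxE => ->; rewrite mul0r.
exists (\prod_i z 0 i ^ lambda i); have -> : B = diag_mx z *m u.
  apply/matrixP => i j; rewrite mxE (bigD1 i) //= big1 => [|k ki].
    by rewrite !mxE eqxx addr0 mulr1n mulrC divfK.
  by rewrite !mxE eq_sym (negPf ki) mulr0n mul0r.
have uSL := unitriangular_SL uu; have zSL : in_SL (diag_mx z) by rewrite /in_SL det_diag.
by rewrite rhoM // -mulmxA v_unip // v_torus.
Qed.

(* [1 + t (g - 1)], with its first row rescaled, is a curve in SL through [g]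
   lying in [U^- T U] for generic [t]; there [rho (u b) v] is a multiple of
   [rho u v] for [b] upper triangular. *)
Lemma big_cell_dense k (Z : 'M[K]_(k, d)) :
  (forall u, upper_unitriangular u^T -> Z *m (rho u *m v) = 0) ->
  forall g, in_SL g -> Z *m (rho g *m v) = 0.
Proof.
move=> Zu g gSL.
pose A : 'M[{poly K}]_r.+1 := \matrix_(i, j) ((i == j)%:R%:P + 'X * (g i j - (i == j)%:R)%:P).
have A0 i j : (A i j).[0] = (i == j)%:R by rewrite mxE hornerD hornerM hornerX !hornerC mul0r addr0.
have [i j ji|i|s s0 sLU] := @lu_generic _ _ A.
- by rewrite A0 -val_eqE gtn_eqF.
- by rewrite A0 eqxx oner_eq0.
pose At t := map_mx (horner^~ t) A.
have detA t : (\det A).[t] = \det (At t) by rewrite -[LHS]/(horner_eval t _) -det_map_mx.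
have At1 : At 1 = g by apply/matrixP => i j; rewrite !mxE hornerD hornerM hornerX !hornerC; ring.
have q1 : (\det A).[1] = 1 by rewrite detA At1.
pose D (t : K) : 'rV[K]_r.+1 := \row_i (if i == ord0 then (\det A).[t]^-1 else 1).
pose c t := diag_mx (D t) *m At t.
have c1 : c 1 = g.
  rewrite /c At1 -[RHS]mul1mx; congr (_ *m _); rewrite -diag_const_mx; congr diag_mx.
  by apply/rowP => i; rewrite !mxE q1 invr1 if_same.
have cSL t : (\det A).[t] != 0 -> in_SL (c t).
  move=> qt; rewrite /in_SL det_mulmx det_diag -detA big_ord_recl big1 => [|i _]; last by rewrite mxE.
  by rewrite mxE eqxx mulr1 mulVf.
apply/matrixP => i j; rewrite [RHS]mxE -c1.
(* Written through [P], the entry under study is visibly regular where \det A does not vanish; it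
   agrees with the entry computed from [rho] because [c t] lies in SL there. *)
pose f t := \sum_a Z i a * \sum_b (P a b).@[fun k => mxvec (c t) 0 k] * v b j.
have f_reg : exists e, regular_der (\det A) f e.
  have creg k1 l : exists e, regular_der (\det A) (fun t => c t k1 l) e.
    have Dreg : exists e, regular_der (\det A) (fun t => D t 0 k1) e.
      have [k10|k10] := eqVneq k1 ord0; eexists.
        apply: (regular_der_ext q1) (regular_der_inv q1) => t _.
        by rewrite mxE k10 eqxx.
      apply: (regular_der_ext q1) (regular_der_const q1 1) => t _.
      by rewrite mxE (negPf k10).
    have [e De] := Dreg; eexists.
    apply: (regular_der_ext q1) (regular_derM q1 De (regular_der_poly (\det A) (A k1 l))) => t _.
    by rewrite /c mul_diag_mx !mxE.
  have /fin_all_exists[e ereg] (k1 : 'I_(r.+1 * r.+1)) :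
      exists e, regular_der (\det A) (fun t => mxvec (c t) 0 k1) e.
    case/mxvec_indexP: k1 => k1 l; have [e creg'] := creg k1 l; exists e.
    by apply: (regular_der_ext q1) creg' => t _; rewrite mxvecE.
  eexists; apply: regular_der_sum => // a _; apply: regular_der_scale => //.
  apply: regular_der_sum => // b _; apply: regular_derM => //; last exact: regular_der_const.
  exact: (regular_der_meval q1 (P a b) ereg).
have fE t : (\det A).[t] != 0 -> f t = (Z *m (rho (c t) *m v)) i j.
  move=> qt; rewrite mxE; apply: eq_bigr => a _; congr (_ * _).
  by rewrite mxE; apply: eq_bigr => b _; rewrite rhoP //; apply: cSL.
rewrite -fE ?q1 ?oner_eq0 //; have [e] := f_reg.
apply: (regular_der_generic0 q1 s0) => t qt st; rewrite fE //.
have [L [U [Ltrig L1 Utrig AtLU]]] := sLU t st.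
pose E := diag_mx (D t); pose E' := diag_mx (map_mx GRing.inv (D t)).
have EE' : E' *m E = 1%:M.
  rewrite mulmx_diag -diag_const_mx; congr diag_mx; apply/rowP => k1; rewrite !mxE.
  by case: ifP; rewrite ?mulVf ?invr_eq0 ?oner_eq0.
(* The rescaling E stands left of L; conjugating L by E keeps it unitriangular and moves E into the
   upper triangular factor. *)
set L' := E *m L *m E'; set U' := E *m U.
have cLU : c t = L' *m U' by rewrite /c /At AtLU /L' -!mulmxA [E' *m _]mulmxA EE' mul1mx.
have Lunip : upper_unitriangular L'^T.
  split=> [a|a b ba]; rewrite mxE /L' mul_mx_diag mxE mul_diag_mx !mxE.
    by rewrite L1 mulr1; case: ifP; rewrite ?divff ?invr_eq0 ?oner_eq0.
  by move/is_trig_mxP: Ltrig => ->; rewrite ?mulr0 ?mul0r.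
have LSL : in_SL L' by rewrite /in_SL -det_tr; exact: unitriangular_SL Lunip.
have USL : in_SL U' by have := cSL t qt; rewrite /in_SL cLU det_mulmx LSL mul1r.
have [|e' Uv] := rep_upper_triangular _ USL.
  apply/is_trig_mxP => a b ab; rewrite mxE /U' mul_diag_mx mxE.
  by move/is_trig_mxP/(_ a b ab): Utrig; rewrite mxE => ->; rewrite mulr0.
by rewrite cLU rhoM // -mulmxA Uv -!scalemxAr Zu // scaler0 mxE.
Qed.

(** U^- is parametrised by all (r+1)^2 coordinates, those on and above the diagonal being ignored,
    so that orbit polynomials live in the same ring as the polynomials [P]. *)
Definition lower_mx (x : 'I_(r.+1 * r.+1) -> K) : 'M[K]_r.+1 :=
  \matrix_(i, j) ((i == j)%:R + (if (j < i)%N then x (mxvec_index i j) else 0)).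

Lemma lower_mx_unitriangular x : upper_unitriangular (lower_mx x)^T.
Proof.
split=> [i|i j ij]; rewrite !mxE ?ltnn ?eqxx ?addr0 //.
by rewrite -val_eqE ltn_eqF // ltnNge ltnW // addr0.
Qed.

Lemma lower_mxK u : upper_unitriangular u^T -> lower_mx (fun k => mxvec u 0 k) = u.
Proof.
move=> [u1 u0]; apply/matrixP => i j; rewrite !mxE mxvecE.
have [<-|] := eqVneq i j; first by have := u1 i; rewrite mxE ltnn addr0.
rewrite neq_ltn => /orP[ij|->]; last by rewrite add0r.
by have := u0 j i ij; rewrite mxE ltnNge ltnW // addr0.
Qed.

Lemma lower_mx_SL x : in_SL (lower_mx x).
Proof.
by rewrite /in_SL -det_tr; apply: unitriangular_SL (lower_mx_unitriangular x).
Qed.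

(** The factor [(j < i)%N%:R] sets the ignored coordinates to 0; [orbit_coef_lower] deduces from it
    that they do not occur in the orbit polynomials. *)
Lemma lower_mx_conj (z : 'rV[K]_r.+1) x : (forall i, z 0 i != 0) ->
  diag_mx z *m lower_mx x = 
  lower_mx (fun k => mxvec (\matrix_(i, j) ((j < i)%N%:R * (z 0 i / z 0 j))) 0 k * x k) *m diag_mx z.
Proof.
move=> z0; apply/matrixP => i j; rewrite mul_diag_mx mul_mx_diag !mxE mxvecE mxE.
have [<-|] := eqVneq i j; first by rewrite ltnn !addr0 mulrC.
by case: ltnP => _ _; rewrite ?addr0 ?mulr0 ?mul0r // !add0r mul1r; field; rewrite z0.
Qed.

(* The coordinates of [rho (lower_mx x) *m v] as polynomials in [x]. *)
Definition orbit_poly (i : 'I_d) : {mpoly K[r.+1 * r.+1]} :=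
  \sum_j v j 0 *: (P i j \mPo [tuple mxvec (\matrix_(a, b) ((a == b)%:R +
     (if (b < a)%N then 'X_(mxvec_index a b) else 0)) : 'M[{mpoly K[r.+1 * r.+1]}]_r.+1) 0 k
       | k < r.+1 * r.+1]).

Lemma orbit_polyE x i : (orbit_poly i).@[x] = (rho (lower_mx x) *m v) i 0.
Proof.
rewrite mxE raddf_sum /=; apply: eq_bigr => j _; rewrite mevalZ mulrC; congr (_ * _).
rewrite comp_mpoly_meval rhoP; last exact: lower_mx_SL.
apply: meval_eq => k; rewrite tnth_mktuple; case/mxvec_indexP: k => a b.
rewrite !mxvecE !mxE mevalD; congr (_ + _).
  by case: (a == b); rewrite ?meval1 ?meval0.
by case: ifP; rewrite ?mevalXU ?meval0.
Qed.

Definition orbit_monomials := undup (flatten [seq msupp (orbit_poly i) | i <- enum 'I_d]).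

Definition orbit_coef m : 'cV[K]_d := \col_i (orbit_poly i)@_m.

Lemma orbit_expansion x :
  rho (lower_mx x) *m v = \sum_(m <- orbit_monomials) (\prod_k x k ^+ m k) *: orbit_coef m.
Proof.
apply/colP => i; rewrite -orbit_polyE summxE.
rewrite (@meval_superset _ _ _ orbit_monomials) ?undup_uniq //.
  by apply: eq_bigr => m _; rewrite !mxE mulrC.
move=> m mi; rewrite mem_undup; apply/flattenP; exists (msupp (orbit_poly i)) => //.
by apply: map_f; rewrite mem_enum.
Qed.

(** Comparison of coefficients for vector-valued polynomials. The scalars [y m] will be torus
    eigenvalues, and [B = 0] turns the lemma into a vanishing criterion. *)
Lemma orbit_coef_eq k (A B : 'M[K]_(k, d)) (y : 'X_{1..r.+1 * r.+1} -> K) :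
  (forall x, \sum_(m <- orbit_monomials) (\prod_k x k ^+ m k) *: (A *m orbit_coef m) =
     \sum_(m <- orbit_monomials) (\prod_k x k ^+ m k) *: (y m *: (B *m orbit_coef m))) ->
  forall m, m \in orbit_monomials -> A *m orbit_coef m = y m *: (B *m orbit_coef m).
Proof.
move=> AB m ms; apply/colP => i; apply/eqP; rewrite -subr_eq0; apply/eqP.
apply: (monomials_free (c := fun m => (A *m orbit_coef m) i 0 - (y m *: (B *m orbit_coef m)) i 0)
  (undup_uniq _) _ ms) => x _.
have /colP/(_ i)/eqP := AB x; rewrite -subr_eq0 !summxE -sumrB => /eqP e; rewrite -[RHS]e.
by apply: eq_bigr => m' _; rewrite !mxE; ring.
Qed.

Lemma orbit_coef_span k (Z : 'M[K]_(k, d)) :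
  (forall m, m \in orbit_monomials -> Z *m orbit_coef m = 0) -> 
  forall g, in_SL g -> Z *m (rho g *m v) = 0.
Proof.
move=> Zm; apply: big_cell_dense => u /lower_mxK <-.
rewrite orbit_expansion mulmx_sumr big_seq big1 // => m ms.
by rewrite -scalemxAr Zm ?scaler0.
Qed.

(** Compare coefficients in rho(z) rho(u(x)) v = z^lambda rho(u(x')) v, where x' is x rescaled by
    conjugation with z. *)
Lemma orbit_coef_torus (z : 'rV[K]_r.+1) m : \prod_i z 0 i = 1 -> m \in orbit_monomials ->
  rho (diag_mx z) *m orbit_coef m = (\prod_i z 0 i ^ lambda i *
    \prod_(i < r.+1) \prod_(j < r.+1) ((j < i)%N%:R * (z 0 i / z 0 j)) ^+ m (mxvec_index i j)) *: orbit_coef m.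
Proof.
move=> z1 ms; have z0 i : z 0 i != 0.
  by apply/eqP => zi; move/eqP: z1; rewrite (bigD1 i) //= zi mul0r eq_sym oner_eq0.
have zSL : in_SL (diag_mx z) by rewrite /in_SL det_diag.
rewrite -[in RHS](mul1mx (orbit_coef m)).
apply: (orbit_coef_eq (y := fun m => \prod_i z 0 i ^ lambda i *
    \prod_(i < r.+1) \prod_(j < r.+1) ((j < i)%N%:R * (z 0 i / z 0 j)) ^+ m (mxvec_index i j)) _ ms) => x.
under [LHS]eq_bigr => m' _ do rewrite scalemxAr.
rewrite -mulmx_sumr -orbit_expansion mulmxA -rhoM //; last exact: lower_mx_SL.
rewrite lower_mx_conj // rhoM //; last exact: lower_mx_SL.
rewrite -mulmxA v_torus // -scalemxAr orbit_expansion scaler_sumr.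
apply: eq_bigr => m' _; rewrite mul1mx !scalerA; congr (_ *: _).
under [X in _ * X = _]eq_bigr => k _ do rewrite exprMn.
rewrite big_split /= [X in _ * (X * _) = _]prod_mxvec.
under [X in _ * (X * _) = _]eq_bigr => i _ do under eq_bigr => j _ do rewrite mxvecE mxE.
by rewrite mulrA mulrC.
Qed.

(** This is lambda plus the sum of m_ij (e_i - e_j). Only pairs with i > j matter for nonzero
    coefficients, so positive roots are subtracted from lambda. *)
Definition orbit_weight (m : 'X_{1..r.+1 * r.+1}) (i : 'I_r.+1) : int :=
  lambda i + \sum_j (m (mxvec_index i j))%:Z - \sum_j (m (mxvec_index j i))%:Z.

(** Put z = 1 in [orbit_coef_torus]: the left side is the coefficient itself, while the right side
    contains 0 ^+ m_ij. *)
Lemma orbit_coef_lower m (i j : 'I_r.+1) : m \in orbit_monomials -> orbit_coef m != 0 ->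
  (i <= j)%N -> m (mxvec_index i j) = 0%N.
Proof.
move=> ms m0 ij; have z1 : \prod_i (const_mx 1 : 'rV[K]_r.+1) 0 i = 1.
  by apply: big1 => k _; rewrite mxE.
have := orbit_coef_torus z1 ms.
have [rho1 _ _] := rho_rep; rewrite diag_const_mx rho1 mul1mx.
move=> e; apply: contraNeq m0 => mij; rewrite e.
set p := (X in (_ * X) *: _); suff -> : p = 0 by rewrite mulr0 scale0r.
rewrite /p (bigD1 i) //= (bigD1 j) //=.
by rewrite ltnNge ij mul0r expr0n (negPf mij) !mul0r.
Qed.

Lemma exprz_sum_nat (I : finType) (F : I -> nat) (x : K) : x != 0 ->
  x ^ (\sum_j (F j)%:Z) = \prod_j x ^+ F j.
Proof.
move=> x0; elim/big_rec2: _ => [|j a b _ <-]; first by rewrite expr0z.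
by rewrite expfzDr.
Qed.

Lemma orbit_coef_weight (z : 'rV[K]_r.+1) m :
  \prod_i z 0 i = 1 -> m \in orbit_monomials -> orbit_coef m != 0 ->
  rho (diag_mx z) *m orbit_coef m = (\prod_i z 0 i ^ orbit_weight m i) *: orbit_coef m.
Proof.
move=> z1 ms m0; rewrite orbit_coef_torus //; congr (_ *: _).
have z0 i : z 0 i != 0.
  by apply/eqP => zi; move/eqP: z1; rewrite (bigD1 i) //= zi mul0r eq_sym oner_eq0.
rewrite /orbit_weight; under [RHS]eq_bigr => i _ do rewrite !expfzDr // -mulrA -exprz_inv.
under [RHS]eq_bigr => i _ do rewrite !exprz_sum_nat ?invr_eq0 //.
rewrite !big_split /=; congr (_ * _); rewrite [X in _ = _ * X]exchange_big -big_split /=.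
apply: eq_bigr => i _; rewrite -big_split /=; apply: eq_bigr => j _.
rewrite exprMn exprMn mulrA; congr (_ * _).
have [ji|ij] := ltnP j i; first by rewrite expr1n mul1r.
by rewrite orbit_coef_lower // !expr0 mulr1.
Qed.

Lemma orbit_weight_sum m : \sum_i orbit_weight m i = \sum_i lambda i.
Proof.
rewrite /orbit_weight sumrB big_split /=.
by rewrite [X in _ - X]exchange_big addrK.
Qed.

Lemma orbit_weight_lt (c : 'I_r.+1 -> int) m : m \in orbit_monomials -> orbit_coef m != 0 ->
  (forall i j : 'I_r.+1, (i < j)%N -> c j < c i) -> m != 0%MM ->
  \sum_i c i * orbit_weight m i < \sum_i c i * lambda i.
Proof.
move=> ms coef0 cdec m0.
rewrite /orbit_weight.
under eq_bigr => i _ do rewrite mulrBr mulrDr -addrA.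
rewrite big_split /= -subr_gt0 opprD addrA subrr sub0r oppr_gt0 sumrB.
under eq_bigr do rewrite mulr_sumr.
under [X in _ - X]eq_bigr do rewrite mulr_sumr.
rewrite [X in _ - X]exchange_big -sumrB.
under eq_bigr do rewrite -sumrB.
have term_le i j : c i * m (mxvec_index i j) - c j * m (mxvec_index i j) <= 0.
  have [ij|ji] := leqP i j; first by rewrite orbit_coef_lower // !mulr0 subrr.
  by rewrite -mulrBl mulr_le0_ge0 // subr_le0 ltW // cdec.
have /existsP[k mk] : [exists k, m k != 0%N].
  apply: contraNT m0 => /existsPn mm0; apply/eqP/mnmP => k.
  by rewrite mnm0E; apply/eqP; rewrite -[_ == _]negbK mm0.
case/mxvec_indexP: k mk => i j mij.
have ji : (j < i)%N by rewrite ltnNge; apply: contraNN mij => ij; rewrite orbit_coef_lower.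
rewrite (bigD1 i) //= (bigD1 j) //=.
rewrite -addrA ltr_wnDr //; last first.
  by rewrite -mulrBl nmulr_rlt0 ?subr_lt0 ?cdec // ltz_nat lt0n.
rewrite -[leRHS]addr0 lerD //; apply: sumr_le0 => k _; first exact: term_le.
by apply: sumr_le0 => l _; apply: term_le.
Qed.

Let orbit_mx : 'M[K]_(size orbit_monomials, d) :=
  \matrix_(k, i) orbit_coef (nth 0%MM orbit_monomials k) i 0.

(** The span of the coefficients is SL-stable: if Z kills all of them, so does Z rho(g), because Z
    rho(g) rho(u) v = Z rho(g u) v = 0 for u in U^-. Irreducibility then makes the span
    everything. *)
Let orbit_mx_full : row_full orbit_mx.
Proof.
rewrite -cokermx_eq0 -trmx_eq0; set Z := (_)^T.
have Zcoef m : m \in orbit_monomials -> Z *m orbit_coef m = 0.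
  move=> ms; have mi : (index m orbit_monomials < size orbit_monomials)%N by rewrite index_mem.
  have := congr1 (row (Ordinal mi)) (mulmx_coker orbit_mx).
  rewrite row_mul row0 => /(congr1 trmx); rewrite trmx_mul trmx0 => <-; congr (_ *m _).
  by apply/colP => i; rewrite !mxE /= nth_index // mxE.
have Zkill := orbit_coef_span Zcoef.
apply/eqP/(irreducible_kernel rho_irr v0) => [|g w gSL Zw].
  by have := Zkill _ (in_SL1 K r.+1); have [-> _ _] := rho_rep; rewrite mul1mx.
have Zg m : m \in orbit_monomials -> Z *m rho g *m orbit_coef m = 0.
  move=> ms; rewrite (orbit_coef_eq (B := 0) (y := fun=> 0) _ ms) ?scale0r // => x.
  under eq_bigr => m' _ do rewrite scalemxAr.
  rewrite -mulmx_sumr -orbit_expansion mulmxA -(mulmxA Z) -rhoM //; last exact: lower_mx_SL.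
  rewrite -mulmxA Zkill; last by apply: in_SLM => //; exact: lower_mx_SL.
  by rewrite big1 // => m' _; rewrite scale0r scaler0.
have /submxP[D wD] : (w^T <= orbit_mx)%MS.
  by rewrite submxE -trmx_eq0 trmx_mul trmxK Zw.
have ZgA : Z *m rho g *m orbit_mx^T = 0.
  apply/matrixP => i k; have := Zg _ (mem_nth 0%MM (ltn_ord k)).
  move=> /colP/(_ i); rewrite !mxE => e; rewrite -[RHS]e; apply: eq_bigr => j _.
  by rewrite !mxE.
by rewrite -[w]trmxK wD trmx_mul !mulmxA ZgA mul0mx.
Qed.

Lemma highest_weight_basis : exists (S : 'M[K]_d) (mu : 'I_d -> 'I_r.+1 -> int) (b0 : 'I_d),
  [/\ S \in unitmx,
      forall z : 'rV[K]_r.+1, \prod_i z 0 i = 1 ->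
        rho (diag_mx z) *m S = S *m diag_mx (\row_b \prod_i z 0 i ^ mu b i),
      mu b0 =1 lambda /\ forall u, upper_unitriangular u -> rho u *m col b0 S = col b0 S,
      forall b, \sum_i mu b i = \sum_i lambda i
    & forall (c : 'I_r.+1 -> int) b, (forall i j : 'I_r.+1, (i < j)%N -> c j < c i) ->
        b != b0 -> \sum_i c i * mu b i < \sum_i c i * lambda i].
Proof.
pose f := fullrankfun orbit_mx_full; pose m b := nth 0%MM orbit_monomials (f b).
have ms b : m b \in orbit_monomials by rewrite mem_nth.
have m_inj : injective m.
  move=> b b' /eqP; rewrite nth_uniq ?undup_uniq //.
  by move=> /eqP/val_inj/fullrankfun_inj.
pose S := (rowsub f orbit_mx)^T.
have colS b : col b S = orbit_coef (m b) by apply/colP => i; rewrite !mxE.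
have Sunit : S \in unitmx by rewrite unitmx_tr fullrowsub_unit.
have coef0 b : orbit_coef (m b) != 0.
  rewrite -colS; apply/negP => /eqP Sb.
  have : invmx S *m S *m delta_mx b (0 : 'I_1) = 0 by rewrite -mulmxA -colE Sb mulmx0.
  rewrite mulVmx // mul1mx => /matrixP/(_ b 0); rewrite !mxE !eqxx.
  by move/eqP; rewrite oner_eq0.
pose mu b := orbit_weight (m b).
have Storus (z : 'rV[K]_r.+1) : \prod_i z 0 i = 1 ->
    rho (diag_mx z) *m S = S *m diag_mx (\row_b \prod_i z 0 i ^ mu b i).
  move=> z1; apply/matrixP => i b; rewrite mul_mx_diag [RHS]mxE.
  have := orbit_coef_weight z1 (ms b) (coef0 b); rewrite -colS {1}colE mulmxA -colE.
  move=> /colP/(_ i); rewrite mxE [RHS]mxE [col b S i 0]mxE mulrC => ->.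
  by congr (_ * _); rewrite mxE.
(* The basis is extracted from the spanning family without control over which members are kept. The
   coordinates of v show that the constant coefficient is among them: coordinates at every other
   monomial vanish, and v is not 0. *)
pose w := invmx S *m v; have vSw : v = S *m w by rewrite mulKVmx.
have w0 b : m b != 0%MM -> w b 0 = 0.
  (* The vector r - 2i is strictly decreasing with sum 0, so z = 2^c lies in the torus of SL and
     gives different eigenvalues to weights with different pairings against c. *)
  move=> mb0; pose c (i : 'I_r.+1) : int := r%:Z - (i + i)%:Z.
  have cdec (i j : 'I_r.+1) : (i < j)%N -> c j < c i by rewrite /c; lia.
  have csum : \sum_i c i = 0.
    suff : \sum_i c i = - \sum_i c i by lia.
    rewrite {1}(reindex_inj rev_ord_inj) -sumrN; apply: eq_bigr => i _; rewrite /c /=.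
    by have := ltn_ord i; lia.
  pose z : 'rV[K]_r.+1 := \row_i 2%:R ^ c i.
  have zpow (e : 'I_r.+1 -> int) : \prod_i z 0 i ^ e i = 2%:R ^ (\sum_i c i * e i).
    elim/big_rec2: _ => [|i x y _ ->]; first by rewrite expr0z.
    by rewrite expfzDr ?pnatr_eq0 // mxE exprz_exp.
  have z1 : \prod_i z 0 i = 1.
    have := zpow (fun=> 1); under eq_bigr => i _ do rewrite expr1z.
    by move=> ->; under eq_bigr => i _ do rewrite mulr1; rewrite csum expr0z.
  have := v_torus z1; rewrite {1 2}vSw mulmxA Storus // -mulmxA scalemxAr.
  move=> /(congr1 (mulmx (invmx S))); rewrite !mulKmx // mul_diag_mx => /colP/(_ b).
  rewrite !mxE !zpow => /eqP; rewrite -subr_eq0 -mulrBl mulf_eq0 subr_eq0.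
  have := orbit_weight_lt (ms b) (coef0 b) cdec mb0; rewrite -/(mu b) => lt.
  case/orP => [/eqP e2|/eqP //]; move: lt.
  by rewrite (exprz2_inj e2) ltxx.
have [b0 wb0] : exists b0, w b0 0 != 0.
  apply/existsP; apply: contraNT v0 => /existsPn w00; rewrite vSw.
  suff -> : w = 0 by rewrite mulmx0.
  by apply/colP => b; rewrite [RHS]mxE; have /negbNE/eqP := w00 b.
have mb0 : m b0 = 0%MM by apply/eqP; apply: contraNT wb0 => /w0 ->.
exists S, mu, b0; split=> //.
- split=> [i|u uu].
    rewrite /mu /orbit_weight mb0 !big1 ?addr0 ?subr0 // => j _; rewrite mnm0E //.
  have vcol : v = w b0 0 *: col b0 S.
    apply/colP => i; rewrite {1}vSw [LHS]mxE [RHS]mxE [col _ _ _ _]mxE (bigD1 b0) //= big1 => [|b bb0].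
      by rewrite addr0 mulrC.
    rewrite w0 ?mulr0 // -mb0; apply: contra_neq bb0; exact: m_inj.
  have := v_unip uu; rewrite vcol -scalemxAr => /(congr1 (fun x => (w b0 0)^-1 *: x)).
  by rewrite !scalerA mulVf // !scale1r.
- by move=> b; apply: orbit_weight_sum.
move=> c b cdec bb0; apply: orbit_weight_lt => //.
by rewrite -mb0; apply: contra_neq bb0; exact: m_inj.
Qed.

End HighestWeight.

(** * The trace of the Casimir operator on the torus *)

Lemma regular_der_exprz (K : numFieldType) (k : int) :
  regular_der 'X (fun a : K => a ^ k) k%:~R.
Proof.
have X1 := hornerX (1 : K); have invr := regular_der_inv X1.
have pos (f : K -> K) d n : f 1 = 1 -> regular_der 'X f d ->
    regular_der 'X (fun a => f a ^+ n) (n%:R * d).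
  move=> f1 fd; elim: n => [|n IH].
    by rewrite mul0r; apply: (regular_der_ext X1) (regular_der_const X1 1) => a _; rewrite expr0.
  apply: (regular_der_ext X1) (regular_der_eq _ (regular_derM X1 fd IH)) => [a _|].
    by rewrite exprS.
  by rewrite f1 expr1n -natr1; ring.
case: k => n.
  have := pos id 1 n (erefl _) (regular_der_id X1); rewrite mulr1.
  by apply: (regular_der_ext X1) => a _.
have f1 : (fun a : K => ('X : {poly K}).[a]^-1) 1 = 1 by rewrite hornerX invr1.
have := pos _ _ n.+1 f1 invr; rewrite derivX hornerC => H.
apply: (regular_der_ext X1) (regular_der_eq _ H) => [a _|].
  by rewrite hornerX NegzE -exprnN exprVn.
by rewrite NegzE mulrNz mulrN1.
Qed.

Lemma regular_diag_exprz (K : numFieldType) n (e : 'I_n -> int) :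
  regular_mxder 'X (fun a : K => diag_mx (\row_i a ^ e i)) (diag_mx (\row_i (e i)%:~R)).
Proof.
have X1 := hornerX (1 : K) => i j; have [<-|ij] := eqVneq i j.
  rewrite !mxE eqxx mulr1n.
  by apply: (regular_der_ext X1) (regular_der_exprz K _) => a _; rewrite !mxE eqxx.
rewrite !mxE (negPf ij) mulr0n.
by apply: (regular_der_ext X1) (regular_der_const X1 0) => a _; rewrite !mxE (negPf ij).
Qed.

Lemma mxtrace_mul_eigenbasis (K : fieldType) d (S A B : 'M[K]_d) (a b : 'rV[K]_d) :
  S \in unitmx -> A *m S = S *m diag_mx a -> B *m S = S *m diag_mx b ->
  \tr (A *m B) = \sum_k a 0 k * b 0 k.
Proof.
move=> Su AS BS; have -> : A *m B = S *m (diag_mx a *m diag_mx b *m invmx S).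
  by rewrite !mulmxA -AS -(mulmxA A) -BS -!mulmxA mulmxV // mulmx1.
rewrite mxtrace_mulC mulmxKV // mulmx_diag mxtrace_diag.
by apply: eq_bigr => k _; rewrite mxE.
Qed.

Section TraceFormula.
Variables (K : numFieldType) (r d : nat).
Variable rho : 'M[K]_r.+1 -> 'M[K]_d.
Variable P : 'I_d -> 'I_d -> {mpoly K[r.+1 * r.+1]}.
Hypothesis rho_rep : SL_representation rho.
Hypothesis rhoP : forall i j g, in_SL g -> rho g i j = (P i j).@[fun k => mxvec g 0 k].
Hypothesis rho_irr : SL_irreducible rho.
Variables (lambda : 'I_r.+1 -> int) (S : 'M[K]_d) (mu : 'I_d -> 'I_r.+1 -> int) (b0 : 'I_d).
Hypothesis S_unit : S \in unitmx.
Hypothesis S_torus : forall z : 'rV[K]_r.+1, \prod_i z 0 i = 1 ->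
  rho (diag_mx z) *m S = S *m diag_mx (\row_b \prod_i z 0 i ^ mu b i).
Hypothesis mu_b0 : mu b0 =1 lambda.
Hypothesis S_unip : forall u, upper_unitriangular u -> rho u *m col b0 S = col b0 S.
Hypothesis mu_sum : forall b, \sum_i mu b i = \sum_i lambda i.

Let E i j : 'M[K]_d := gl_action P (\sum_i lambda i)%:~R (delta_mx i j).

Lemma mxtrace_torus (z : 'rV[K]_r.+1) : \prod_i z 0 i = 1 ->
  \tr (rho (diag_mx z)) = \sum_b \prod_i z 0 i ^ mu b i.
Proof.
move=> /S_torus zS; have S1 : 1%:M *m S = S *m diag_mx (const_mx 1).
  by rewrite mul1mx diag_const_mx mulmx1.
rewrite -[rho _]mulmx1 (mxtrace_mul_eigenbasis S_unit zS S1).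
by apply: eq_bigr => b _; rewrite !mxE mulr1.
Qed.

Lemma mxtrace_torus_perm (s : 'S_r.+1) (z : 'rV[K]_r.+1) : \prod_i z 0 i = 1 ->
  \sum_b \prod_i z 0 (s i) ^ mu b i = \sum_b \prod_i z 0 i ^ mu b i.
Proof.
move=> z1; pose zs : 'rV[K]_r.+1 := \row_i z 0 (s i).
have zs1 : \prod_i zs 0 i = 1.
  by rewrite -[RHS]z1 [RHS](reindex_inj (@perm_inj _ s)); apply: eq_bigr => i _; rewrite mxE.
transitivity (\tr (rho (diag_mx zs))).
  by rewrite mxtrace_torus //; apply: eq_bigr => b _; apply: eq_bigr => i _; rewrite mxE.
rewrite -mxtrace_torus //.
(* The permutation matrix has determinant the sign of s; this sign on the first row brings the
   product into SL. *)
pose e : 'rV[K]_r.+1 := \row_i (if i == ord0 then (-1) ^+ s else 1).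
pose g := diag_mx e *m perm_mx s.
have gSL : in_SL g.
  rewrite /in_SL det_mulmx det_diag det_perm big_ord_recl big1 => [|i _]; last by rewrite mxE.
  by rewrite mxE eqxx mulr1 -signr_addb addbb.
have gz : g *m diag_mx z = diag_mx zs *m g.
  rewrite /g [RHS]mulmxA mulmx_diag -mulmxA.
  have -> : perm_mx s *m diag_mx z = diag_mx zs *m perm_mx s.
    apply/matrixP => i j; rewrite mul_mx_diag mul_diag_mx !mxE.
    by case: eqVneq => [->|]; rewrite ?mul0r ?mulr0 // mulrC.
  rewrite mulmxA mulmx_diag; congr (diag_mx _ *m _).
  by apply/rowP => i; rewrite !mxE mulrC.
have zSL : in_SL (diag_mx z) by rewrite /in_SL det_diag.
have zsSL : in_SL (diag_mx zs) by rewrite /in_SL det_diag.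
have [_ rhoM _] := rho_rep.
have rgV := repV rho_rep gSL.
rewrite -[rho (diag_mx zs)]mulmx1 -rgV mulmxA -rhoM // -gz rhoM // mxtrace_mulC mulmxA.
by rewrite (mulmx1C rgV) mul1mx.
Qed.

(** Coroot curves only give E_ii - E_jj, with eigenvalues mu_i - mu_j. The trace direction is fixed
    by the scalar of the identity, which equals the coordinate sum of every weight. *)
Lemma gl_action_diag i : E i i *m S = S *m diag_mx (\row_b (mu b i)%:~R).
Proof.
have X1 := hornerX (1 : K).
have Eij j : (E i i - E j j) *m S = S *m diag_mx (\row_b (mu b i - mu b j)%:~R).
  have [->|ij] := eqVneq i j.
    rewrite subrr mul0mx; apply/esym; rewrite -[RHS](mulmx0 _ S); congr (_ *m _).
    by apply/matrixP => a b; rewrite !mxE subrr mul0rn.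
  rewrite /E -linearB /= gl_action_tr0; last by rewrite linearB /= !mxtrace_delta_eq subrr.
  have tSL (a : K) : ('X : {poly K}).[a] != 0 -> in_SL (torus_curve i j a).
    by rewrite hornerX; apply: torus_curve_SL.
  have d1 := rep_regular_curve rhoP X1 (torus_curve1 K i j) tSL (regular_torus_curve K ij).
  have d2 := regular_mxderM X1 d1 (regular_mxder_const X1 S).
  rewrite mulmx0 addr0 in d2; apply: (regular_mxder_uniq X1 d2).
  have d3 := regular_diag_exprz K (fun b => mu b i - mu b j).
  have d4 := regular_mxderM X1 (regular_mxder_const X1 S) d3.
  rewrite mul0mx add0r in d4; apply: (regular_mxder_ext X1) d4 => a.
  rewrite hornerX => a0; rewrite /= /torus_curve S_torus ?torus_curve_prod //.
  congr (S *m diag_mx _); apply/rowP => b; rewrite !mxE.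
  rewrite (bigD1 i) //= (bigD1 j) 1?eq_sym //= !mxE !eqxx eq_sym (negPf ij) big1 => [|k].
    by rewrite mulr1 exprz_inv expfzDr.
  by case/andP => ki kj; rewrite mxE (negPf ki) (negPf kj) exp1rz.
apply: (scalerI (_ : r.+1%:R != 0)); first by rewrite pnatr_eq0.
have sumE : \sum_j E j j = (\sum_i lambda i)%:~R%:M.
  rewrite /E -linear_sum /= -(gl_action1 P); congr (gl_action P _ _); apply/matrixP => a b.
  rewrite summxE (bigD1 a) //= big1 ?addr0 => [|k ka]; first by rewrite !mxE eqxx eq_sym.
  by rewrite !mxE eq_sym (negPf ka).
have -> : r.+1%:R *: (E i i *m S) = \sum_j (E i i - E j j) *m S + (\sum_j E j j) *m S.
  by rewrite -mulmx_suml -mulmxDl sumrB subrK sumr_const card_ord -scaler_nat -scalemxAl.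
rewrite sumE mul_scalar_mx (eq_bigr _ (fun j _ => Eij j)).
apply/matrixP => a b; rewrite [LHS]mxE [RHS]mxE summxE.
under [X in X + _]eq_bigr => j _ do rewrite mul_mx_diag !mxE.
rewrite mul_mx_diag !mxE -mulr_sumr -(mu_sum b).
rewrite (big_morph (fun n : int => n%:~R : K) (intrD K) (mulr0z 1)).
under [X in _ * X]eq_bigr => j _ do rewrite intrB.
rewrite sumrB sumr_const card_ord -mulr_natl; ring.
Qed.

Lemma torus_gl_action_conj (z : 'rV[K]_r.+1) i j : \prod_i z 0 i = 1 ->
  rho (diag_mx z) *m E i j = (z 0 i / z 0 j) *: (E i j *m rho (diag_mx z)).
Proof.
move=> z1; have z0 k : z 0 k != 0.
  by apply/eqP => zk; move/eqP: z1; rewrite (bigD1 k) //= zk mul0r eq_sym oner_eq0.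
have zSL : in_SL (diag_mx z) by rewrite /in_SL det_diag.
rewrite /E (gl_action_conj rho_rep rhoP _ _ zSL) scalemxAl -linearZ /=; congr (gl_action _ _ _ *m _).
apply: (canLR (mulmxK (in_SL_unit zSL))); apply/matrixP => a b.
rewrite mul_diag_mx mul_mx_diag !mxE.
case: eqVneq => [->|]; case: eqVneq => [->|]; rewrite ?mulr0 ?mul0r //= !mulr1.
by rewrite divfK.
Qed.

(** Let x and y be the traces against E_ij E_ji and E_ji E_ij. Cyclicity and the commutation with
    the torus give x = (z_i / z_j) y, the bracket gives x - y, and the two equations are solved for
    x. *)
Lemma mxtrace_gl_action (z : 'rV[K]_r.+1) i j : \prod_i z 0 i = 1 -> z 0 i != z 0 j ->
  \tr (rho (diag_mx z) *m (E i j *m E j i)) = z 0 i / (z 0 i - z 0 j) *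
    (\sum_b (mu b i)%:~R * \prod_k z 0 k ^ mu b k - \sum_b (mu b j)%:~R * \prod_k z 0 k ^ mu b k).
Proof.
move=> z1 zij; have ij : i != j by apply: contraNneq zij => ->.
have z0 k : z 0 k != 0.
  by apply/eqP => zk; move/eqP: z1; rewrite (bigD1 k) //= zk mul0r eq_sym oner_eq0.
have diagE k : \tr (rho (diag_mx z) *m E k k) = \sum_b (mu b k)%:~R * \prod_k z 0 k ^ mu b k.
  rewrite (mxtrace_mul_eigenbasis S_unit (S_torus z1) (gl_action_diag k)).
  by apply: eq_bigr => b _; rewrite !mxE mulrC.
set x := \tr _; pose y := \tr (rho (diag_mx z) *m (E j i *m E i j)).
have xy : x = z 0 i / z 0 j * y.
  rewrite /x mulmxA torus_gl_action_conj // -scalemxAl mxtraceZ; congr (_ * _).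
  by rewrite -mulmxA mxtrace_mulC -mulmxA.
rewrite -!diagE -linearB /= -mulmxBr.
have -> : E i i - E j j = E i j *m E j i - E j i *m E i j.
  by rewrite /E (gl_action_bracket rho_rep rhoP _ ij) linearB.
rewrite mulmxBr linearB /= -/x -/y xy.
by field; rewrite z0 subr_eq0.
Qed.

(** Raising operators annihilate the highest weight vector: rho (1 + (a - 1) E_ij) fixes it for
    every a, so the derivative is 0. *)
Let lowest (i j : 'I_r.+1) : (i < j)%N -> E i j *m col b0 S = 0.
Proof.
move=> ij; have nij : i != j by rewrite neq_ltn ij.
have X1 := hornerX (1 : K).
have tSL a : ('X : {poly K}).[a] != 0 -> in_SL (transvection i j (a - 1)).
  by move=> _; apply: transvection_SL.
have d0 := @rep_regular_curve _ _ _ _ _ rhoP 'X (fun a => transvection i j (a - 1)) _ X1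
  (transvection0 K i j) tSL (regular_transvection K i j).
have := regular_mxderM X1 d0 (regular_mxder_const X1 (col b0 S)).
rewrite mulmx0 addr0 /E gl_action_tr0 ?mxtrace_delta_neq // => d1.
apply: (regular_mxder_uniq X1 d1).
apply: (regular_mxder_ext X1) (regular_mxder_const X1 (col b0 S)) => a _ /=.
rewrite S_unip //; split=> [k|k l kl]; rewrite !mxE.
  suff -> : (k == i) && (k == j) = false by rewrite eqxx mulr0 addr0.
  by apply/negP => /andP[/eqP ki /eqP kj]; rewrite -ki kj eqxx in nij.
rewrite -val_eqE gtn_eqF // add0r; suff -> : (k == i) && (l == j) = false by rewrite mulr0.
by apply/negP => /andP[/eqP ki /eqP lj]; move: kl ij; rewrite ki lj; lia.
Qed.

(** On the highest weight vector E_ij E_ji gives lambda_i^2 when i = j, the bracket eigenvalue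
    lambda_i - lambda_j when i < j, and 0 when i > j because E_ji acts first and kills it. *)
Lemma casimir_scalar : casimir P (\sum_i lambda i)%:~R =
  (\sum_i lambda i ^+ 2 + \sum_(i < r.+1) \sum_(j < r.+1 | (i < j)%N) (lambda i - lambda j))%:~R%:M.
Proof.
set s := (_)%:~R; set c := (_ + _).
have colb0 : col b0 S != 0.
  apply/negP => /eqP Sb.
  have : invmx S *m S *m delta_mx b0 (0 : 'I_1) = 0 by rewrite -mulmxA -colE Sb mulmx0.
  rewrite mulVmx // mul1mx => /matrixP/(_ b0 0); rewrite !mxE !eqxx.
  by move/eqP; rewrite oner_eq0.
have diagE i : E i i *m col b0 S = (lambda i)%:~R *: col b0 S.
  rewrite {1}colE mulmxA gl_action_diag -colE; apply/colP => k.
  by rewrite mxE mul_mx_diag !mxE mu_b0 mulrC.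
apply/eqP; rewrite -subr_eq0; apply/eqP.
apply: (irreducible_kernel rho_irr colb0) => [|g w gSL].
  rewrite mulmxBl mul_scalar_mx; apply/eqP; rewrite subr_eq0; apply/eqP.
  rewrite /casimir mulmx_suml /c rmorphD /= scalerDl !rmorph_sum !scaler_suml -big_split /=.
  apply: eq_bigr => i _; rewrite mulmx_suml (bigD1 i) //= -/(E i i).
  rewrite -mulmxA diagE -scalemxAr diagE scalerA -rmorphM; congr (_ + _).
  rewrite rmorph_sum scaler_suml [RHS]big_mkcond [LHS]big_mkcond; apply: eq_bigr => j _.
  rewrite -/(E i j) -/(E j i).
  have [->|ij] := eqVneq i j; first by rewrite ltnn.
  case: ltnP => [lt|le] /=; last first.
    by rewrite -mulmxA lowest ?mulmx0 // ltn_neqAle eq_sym ij.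
  have := gl_action_bracket rho_rep rhoP s ij.
  rewrite -/(E i j) -/(E j i) linearB -/(E i i) -/(E j j) /=.
  move=> /(congr1 (mulmx^~ (col b0 S))); rewrite !mulmxBl !diagE -[X in _ - X]mulmxA lowest //.
  by rewrite mulmx0 subr0 => ->; rewrite -scalerBl -rmorphB.
rewrite !mulmxBl => /eqP; rewrite subr_eq0 => /eqP Cw.
rewrite mulmxA -(casimir_comm rho_rep rhoP _ gSL) -mulmxA Cw !mul_scalar_mx.
by rewrite scalemxAr subrr.
Qed.

Lemma trace_formula (z : 'rV[K]_r.+1) : \prod_i z 0 i = 1 ->
  (forall i j, i != j -> z 0 i != z 0 j) ->
  (\sum_i lambda i ^+ 2 + \sum_(i < r.+1) \sum_(j < r.+1 | (i < j)%N) (lambda i - lambda j))%:~R *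
    \sum_b \prod_k z 0 k ^ mu b k =
  \sum_i (\sum_b (mu b i ^+ 2)%:~R * \prod_k z 0 k ^ mu b k +
    \sum_(j | j != i) z 0 i / (z 0 i - z 0 j) * (\sum_b (mu b i)%:~R * \prod_k z 0 k ^ mu b k
      - \sum_b (mu b j)%:~R * \prod_k z 0 k ^ mu b k)).
Proof.
move=> z1 zij; rewrite -mxtrace_torus // -mxtraceZ -mul_mx_scalar -casimir_scalar.
rewrite /casimir mulmx_sumr linear_sum; apply: eq_bigr => i _ /=.
rewrite mulmx_sumr linear_sum (bigD1 i) //=; congr (_ + _).
  have EE : (E i i *m E i i) *m S = S *m diag_mx (\row_b (mu b i ^+ 2)%:~R).
    rewrite -mulmxA gl_action_diag mulmxA gl_action_diag -mulmxA mulmx_diag.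
    by congr (S *m diag_mx _); apply/rowP => b; rewrite !mxE rmorphXn expr2.
  rewrite (mxtrace_mul_eigenbasis S_unit (S_torus z1) EE).
  by apply: eq_bigr => b _; rewrite !mxE mulrC.
by apply: eq_bigr => j ji; rewrite mxtrace_gl_action // zij // eq_sym.
Qed.

End TraceFormula.

(** * Rearrangement and the Euler operators *)

Lemma sum_ltn_ord n (k : 'I_n) : (\sum_(j < n) (j < k))%N = k.
Proof.
by rewrite -big_mkcond -(big_ord_widen n (fun=> 1%N)) ?sum1_card ?card_ord // ltnW.
Qed.

Lemma sum_ltn_perm n (s : 'S_n) (i : 'I_n) : (\sum_(j < n) (s j < s i))%N = s i.
Proof. by rewrite -[RHS]sum_ltn_ord [RHS](reindex_inj (@perm_inj _ s)). Qed.

(** Without inversions s preserves the order, so s i, which counts the j with s j < s i, is also the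
    number of j < i. *)
Lemma perm_inversion n (s : 'S_n) : s != 1%g ->
  exists i j : 'I_n, (i < j)%N /\ (s j < s i)%N.
Proof.
move=> s1; suff /existsP[i /existsP[j /andP[]]] :
  [exists i : 'I_n, [exists j : 'I_n, (i < j)%N && (s j < s i)%N]] by exists i, j.
apply: contraNT s1 => /existsPn noinv.
have noinvP (i j : 'I_n) : (i < j)%N -> (s i < s j)%N.
  move=> ij; have /existsPn/(_ j) := noinv i; rewrite ij -leqNgt leq_eqVlt /=.
  by case/orP => // /eqP/val_inj/perm_inj e; rewrite e ltnn in ij.
apply/eqP/permP => i; apply: val_inj; rewrite perm1 /= -sum_ltn_perm -[RHS]sum_ltn_ord.
apply: eq_bigr => j _; have [<-|] := eqVneq i j; first by rewrite !ltnn.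
rewrite neq_ltn => /orP[] ij; have sij := noinvP _ _ ij; last by rewrite ij sij.
by rewrite !ltnNge (ltnW ij) (ltnW sij).
Qed.

(* [\sum c_i (s i - i)] is the sum of [c_i - c_j] over the inversions [i < j] of [s]. *)
Lemma perm_rearrangement n (s : 'S_n) (c : 'I_n -> int) : s != 1%g ->
  (forall i j : 'I_n, (i < j)%N -> c j < c i) ->
  0 < \sum_i c i * ((s i)%:Z - i%:Z).
Proof.
move=> s1 cdec; pose t (i j : 'I_n) := (s j < s i)%N%:Z - (j < i)%N%:Z.
have sumT : \sum_i c i * ((s i)%:Z - i%:Z) = \sum_i \sum_j c i * t i j.
  apply: eq_bigr => i _; rewrite -mulr_sumr sumrB; congr (_ * (_ - _)).
    by rewrite -[in LHS]sum_ltn_perm (big_morph Posz PoszD (erefl _)).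
  by rewrite -[in LHS]sum_ltn_ord (big_morph Posz PoszD (erefl _)).
have tC i j : t j i = - t i j.
  rewrite /t; have [->|ij] := eqVneq i j; first by rewrite !ltnn.
  have : s i != s j by rewrite (inj_eq perm_inj).
  by move: ij; rewrite -!val_eqE /=; lia.
suff H : 0 < \sum_i \sum_j (c i - c j) * t i j.
  have E : \sum_i \sum_j (c i - c j) * t i j = (\sum_i \sum_j c i * t i j) *+ 2.
    rewrite mulr2n; under eq_bigr => i _ do under eq_bigr => j _ do rewrite mulrBl.
    under eq_bigr => i _ do rewrite sumrB; rewrite sumrB; congr (_ + _).
    rewrite exchange_big -sumrN; apply: eq_bigr => i _; rewrite -sumrN.
    by apply: eq_bigr => j _; rewrite tC mulrN opprK.
  by move: H; rewrite sumT E pmulrn_lgt0.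
have term_ge0 i j : 0 <= (c i - c j) * t i j.
  rewrite /t; have [->|] := eqVneq i j; first by rewrite subrr mul0r.
  rewrite neq_ltn => /orP[] /= ij; have cij := cdec _ _ ij.
    by apply: mulr_ge0; lia.
  by apply: mulr_le0; lia.
have [i [j [ij sji]]] := perm_inversion s1.
rewrite (bigD1 i) //= (bigD1 j) //=.
have : 0 < (c i - c j) * t i j.
  by have cij := cdec _ _ ij; apply: mulr_gt0; rewrite ?/t; lia.
move=> t0; rewrite -addrA ltr_wpDr //; apply: addr_ge0; apply: sumr_ge0 => // k _.
exact: sumr_ge0.
Qed.

Section Euler.
Variables (K : numFieldType) (n : nat).
Implicit Types (p q : {mpoly K[n]}) (i : 'I_n).

Definition euler i p : {mpoly K[n]} := 'X_i * p^`M(i).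

Fact euler_is_linear i : linear (euler i).
Proof. by move=> a p q; rewrite /euler linearP mulrDr scalerAr. Qed.

HB.instance Definition _ i := GRing.isLinear.Build K {mpoly K[n]} {mpoly K[n]} *:%R
  (euler i) (euler_is_linear i).

Lemma eulerM i p q : euler i (p * q) = euler i p * q + p * euler i q.
Proof. by rewrite /euler mderivM; ring. Qed.

Lemma meval_eulerM i p q x : (euler i (p * q)).@[x] =
  (euler i p).@[x] * q.@[x] + p.@[x] * (euler i q).@[x].
Proof. by rewrite eulerM mevalD; congr (_ + _); exact: mevalM. Qed.

Lemma eulerX i m : euler i 'X_[m] = (m i)%:R *: 'X_[m].
Proof.
rewrite /euler mderivX -scalerAr -mpolyXD.
have [->|mi] := eqVneq (m i) 0%N; first by rewrite !scale0r.
by rewrite addmC submK // lep1mP.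
Qed.

Definition euler_laplacian p : {mpoly K[n]} := \sum_i euler i (euler i p).

Fact euler_laplacian_is_linear : linear euler_laplacian.
Proof.
move=> a p q; rewrite /euler_laplacian scaler_sumr -big_split; apply: eq_bigr => i _.
by rewrite !linearP.
Qed.

HB.instance Definition _ := GRing.isLinear.Build K {mpoly K[n]} {mpoly K[n]} *:%R
  euler_laplacian euler_laplacian_is_linear.

Lemma euler_laplacianX m : euler_laplacian 'X_[m] = (\sum_i (m i) ^ 2)%:R *: 'X_[m].
Proof.
rewrite natr_sum scaler_suml; apply: eq_bigr => i _.
by rewrite eulerX linearZ /= eulerX scalerA -natrM.
Qed.

Lemma mcoeff_euler_laplacian p m :
  (euler_laplacian p)@_m = (\sum_i (m i) ^ 2)%:R * p@_m.
Proof.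
rewrite [p in LHS]mpolyE (linear_sum euler_laplacian) (linear_sum (mcoeff m)) /=.
under [LHS]eq_bigr => k _ do rewrite linearZ /= euler_laplacianX !mcoeffZ mcoeffX.
have [mp|mp] := boolP (m \in msupp p); last first.
  rewrite (memN_msupp_eq0 mp) mulr0 big_seq big1 // => k kp.
  by case: eqP => [km|]; rewrite ?mulr0 // -km kp in mp *.
rewrite (bigD1_seq m) ?msupp_uniq //= eqxx [X in _ + X]big1 => [|k /negPf ->].
  by rewrite addr0 mulr1 mulrC.
by rewrite !mulr0.
Qed.

Lemma euler_laplacianM p q : euler_laplacian (p * q) =
  euler_laplacian p * q + (\sum_i euler i p * euler i q) *+ 2 + p * euler_laplacian q.
Proof.
rewrite /euler_laplacian mulr_suml mulr_sumr -sumrMnl -!big_split; apply: eq_bigr => i _ /=.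
by rewrite eulerM linearD /= !eulerM; ring.
Qed.

Lemma euler_prod_meval (I : Type) (s : seq I) (P : pred I) (F : I -> {mpoly K[n]}) i x :
  (forall k, P k -> (F k).@[x] != 0) ->
  (euler i (\prod_(k <- s | P k) F k)).@[x] =
  (\prod_(k <- s | P k) F k).@[x] * \sum_(k <- s | P k) (euler i (F k)).@[x] / (F k).@[x].
Proof.
move=> F0; elim: s => [|k s IH].
  by rewrite !big_nil /euler mderivC mulr0 meval0 mulr0.
rewrite !big_cons; case: ifP => // Pk.
rewrite meval_eulerM IH mevalM; field; exact: F0.
Qed.

(** A logarithmic derivative: only the factors containing X_i contribute, and those with j < i and
    those with j > i both give x_i / (x_i - x_j). *)
Lemma euler_vandermonde_meval i x : (forall j k : 'I_n, j != k -> x j != x k) ->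
  (euler i (\prod_(j < n) \prod_(k < n | (j < k)%N) ('X_k - 'X_j))).@[x] =
  (\prod_(j < n) \prod_(k < n | (j < k)%N) ('X_k - 'X_j) : {mpoly K[n]}).@[x] *
    \sum_(j | j != i) x i / (x i - x j).
Proof.
move=> xd; pose F (jk : 'I_n * 'I_n) : {mpoly K[n]} := 'X_jk.2 - 'X_jk.1.
have FE jk : (F jk).@[x] = x jk.2 - x jk.1 by rewrite mevalB !mevalXU.
rewrite !pair_big_dep /=.
have -> : \prod_(p : 'I_n * 'I_n | (p.1 < p.2)%N) ('X_p.2 - 'X_p.1) =
  \prod_(p : 'I_n * 'I_n | (p.1 < p.2)%N) F p by [].
rewrite euler_prod_meval => [|jk lt]; last first.
  by rewrite FE subr_eq0 xd // neq_ltn lt orbT.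
congr (_ * _); transitivity (\sum_(j < n) \sum_(k < n | (j < k)%N) (euler i (F (j, k))).@[x] / (F (j, k)).@[x]).
  by rewrite pair_big_dep; apply: eq_bigr => -[].
have eulF j k : (euler i (F (j, k))).@[x] = (k == i)%:R * x i - (j == i)%:R * x i.
  rewrite linearB /= !eulerX mevalB !mevalZ !mevalXU !mnm1E.
  by do 2!case: eqVneq => [->|_]; rewrite ?mul0r.
have -> : \sum_(j < n) \sum_(k < n | (j < k)%N) (euler i (F (j, k))).@[x] / (F (j, k)).@[x] =
    \sum_(j < n) \sum_(k < n | (j < k)%N) (k == i)%:R * x i / (x k - x j) -
    \sum_(j < n) \sum_(k < n | (j < k)%N) (j == i)%:R * x i / (x k - x j).
  rewrite -sumrB; apply: eq_bigr => j _; rewrite -sumrB; apply: eq_bigr => k _.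
  by rewrite eulF FE mulrBl.
rewrite [RHS](bigID (fun j : 'I_n => (j < i)%N)) /=; congr (_ + _).
  rewrite (exchange_big_dep predT) //= (bigD1 i) //= [X in _ + X]big1 => [|k ki].
    rewrite addr0; apply: eq_big => [j|j ji]; last by rewrite eqxx mul1r.
    by case: ltngtP => //; rewrite ?andbF // => ji; rewrite -val_eqE ltn_eqF.
  by rewrite big1 // => j _; rewrite (negPf ki) !mul0r.
rewrite (bigD1 i) //= [X in _ + X]big1 => [|j ji]; last first.
  by rewrite big1 // => k _; rewrite (negPf ji) !mul0r.
rewrite addr0 -sumrN; apply: eq_big => [j|j ji].
  by rewrite -val_eqE /=; case: ltngtP.
by rewrite eqxx mul1r -mulrN -invrN opprB.
Qed.

End Euler.

(** * Alternants *)

Section Alternant.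
Variables (K : numFieldType) (n : nat).
Implicit Types (e : 'I_n -> nat) (s : 'S_n).

Definition alternant e : {mpoly K[n]} := \det (\matrix_(i, k) 'X_k ^+ e i).

Lemma meval_alternant e x : (alternant e).@[x] = \det (\matrix_(i, k) x k ^+ e i).
Proof.
rewrite /alternant -det_map_mx; congr (\det _); apply/matrixP => i k.
by rewrite !mxE rmorphXn /= mevalXU.
Qed.

Lemma alternantE e :
  alternant e = \sum_(s : 'S_n) (-1) ^+ s *: 'X_[[multinom e (s k) | k < n]].
Proof.
rewrite /alternant /determinant (reindex_inj invg_inj) /=; apply: eq_bigr => s _.
rewrite odd_permV -mul_mpolyC rmorphXn rmorphN1; congr (_ * _).
rewrite mpolyXE_id (reindex_inj (@perm_inj _ s)) /=; apply: eq_bigr => k _.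
by rewrite mxE permK mnmE.
Qed.

Lemma msym_alternant e s : msym s (alternant e) = (-1) ^+ s *: alternant e.
Proof.
rewrite !alternantE linear_sum scaler_sumr (reindex_inj (mulgI s)) /=.
apply: eq_bigr => t _; rewrite linearZ /= msymX scalerA odd_permM signr_addb; congr (_ *: 'X_[_]).
by apply/mnmP => k; rewrite !mnmE permM permKV.
Qed.

Lemma mcoeff_alternant e (m : 'X_{1..n}) :
  (alternant e)@_m = \sum_(s : 'S_n | [multinom e (s k) | k < n] == m) (-1) ^+ s.
Proof.
rewrite alternantE linear_sum [RHS]big_mkcond; apply: eq_bigr => s _ /=.
by rewrite mcoeffZ mcoeffX; case: eqP; rewrite ?mulr1 ?mulr0.
Qed.

End Alternant.

(** The sign comes from reversing the rows. It is left unspecified since only the logarithmic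
    derivative and the non-vanishing of the product are read off. *)
Lemma alternant_vandermonde (K : numFieldType) r :
  exists b : bool, alternant K (fun i : 'I_r.+1 => r - i)%N =
    (-1) ^+ b *: \prod_(j < r.+1) \prod_(k < r.+1 | (j < k)%N) ('X_k - 'X_j).
Proof.
pose X : 'rV[{mpoly K[r.+1]}]_r.+1 := \row_k 'X_k.
exists (perm (@rev_ord_inj r.+1)); transitivity (\det (row_perm (perm (@rev_ord_inj r.+1)) (Vandermonde r.+1 X))).
  by congr (\det _); apply/matrixP => i k; rewrite !mxE permE /= subSS.
rewrite row_permE det_mulmx det_perm det_Vandermonde -mul_mpolyC rmorphXn rmorphN1.
congr (_ * _); apply: eq_bigr => j _; apply: eq_bigr => k _; by rewrite !mxE.
Qed.

(** Look at the leading monomial. If m_i = m_j with i < j, the transposition forces its coefficient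
    to be 0; if m_i < m_j, swapping gives a larger monomial of the support. So it is strictly
    decreasing. *)
Lemma antisym_eq0 (K : numFieldType) n (p : {mpoly K[n]}) :
  (forall s, msym s p = (-1) ^+ s *: p) ->
  (forall m : 'X_{1..n}, (forall i j : 'I_n, (i < j)%N -> (m j < m i)%N) -> p@_m = 0) ->
  p = 0.
Proof.
move=> anti strict0; apply/eqP; apply: contraT => p0.
have coefE (s : 'S_n) (m : 'X_{1..n}) : p@_[multinom m (s i) | i < n] = (-1) ^+ s * p@_m.
  by rewrite -mcoeff_sym anti mcoeffZ.
have lead0 : p@_(mlead p) != 0 by rewrite mleadc_eq0.
rewrite -(negPf lead0); apply/eqP/strict0 => i j ij; rewrite ltnNge; apply/negP => le_m.
have nij : i != j by rewrite neq_ltn ij.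
have := coefE (tperm i j) (mlead p); rewrite odd_tperm nij expr1 mulN1r.
set ms := [multinom _ | _ < n] => pms.
have [eq_m|ne_m] := eqVneq (mlead p i) (mlead p j).
  have ms_lead : ms = mlead p.
    by apply/mnmP => k; rewrite mnmE; case: tpermP => // ->.
  move/eqP: pms; rewrite ms_lead -addr_eq0 -mulr2n -mulr_natl mulf_eq0 pnatr_eq0.
  by rewrite (negPf lead0).
have lt_ms : (mlead p < ms)%O.
  apply/ltmcP; first by rewrite mdeg_mperm.
  exists i => [k ki|]; last by rewrite mnmE tpermL ltn_neqAle ne_m.
  by rewrite mnmE tpermD // neq_ltn ?ki ?(ltn_trans ki ij) orbT.
have : ms \in msupp p by rewrite mcoeff_msupp pms oppr_eq0.
by move/msupp_le_mlead; rewrite leNgt lt_ms.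
Qed.

(** * The alternant identity for weights with non-negative entries *)

Section WeylAlternant.
Variables (K : numFieldType) (r d : nat) (mu : 'I_d -> 'X_{1..r.+1}) (b0 : 'I_d).
Let rho0 := fun i : 'I_r.+1 => (r - i)%N.
Let l i := (mu b0 i + (r - i))%N.

Hypothesis mu_deg : forall b, mdeg (mu b) = mdeg (mu b0).
Hypothesis mu_lt : forall (c : 'I_r.+1 -> int) b,
  (forall i j : 'I_r.+1, (i < j)%N -> c j < c i) -> b != b0 ->
  \sum_i c i * (mu b i)%:Z < \sum_i c i * (mu b0 i)%:Z.
Hypothesis mu_dominant : forall i j : 'I_r.+1, (i <= j)%N -> (mu b0 j <= mu b0 i)%N.
Hypothesis mu_sym : forall (s : 'S_r.+1) (x : 'I_r.+1 -> K), (forall i, x i != 0) ->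
  \sum_b \prod_i x (s i) ^+ mu b i = \sum_b \prod_i x i ^+ mu b i.
Hypothesis mu_trace : forall x : 'I_r.+1 -> K, (forall i, x i != 0) ->
  (forall i j, i != j -> x i != x j) ->
  (\sum_i (mu b0 i)%:R ^+ 2 +
     \sum_(i < r.+1) \sum_(j < r.+1 | (i < j)%N) ((mu b0 i)%:R - (mu b0 j)%:R)) *
    \sum_b \prod_k x k ^+ mu b k =
  \sum_i (\sum_b (mu b i)%:R ^+ 2 * \prod_k x k ^+ mu b k +
    \sum_(j | j != i) x i / (x i - x j) * (\sum_b (mu b i)%:R * \prod_k x k ^+ mu b k
      - \sum_b (mu b j)%:R * \prod_k x k ^+ mu b k)).

Let chi : {mpoly K[r.+1]} := \sum_b 'X_[mu b].
Let A : {mpoly K[r.+1]} := alternant K rho0.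

Let meval_chi x : chi.@[x] = \sum_b \prod_k x k ^+ mu b k.
Proof. by rewrite raddf_sum; apply: eq_bigr => b _; rewrite /= mevalX. Qed.

Let meval_euler_chi i x : (euler i chi).@[x] = \sum_b (mu b i)%:R * \prod_k x k ^+ mu b k.
Proof.
rewrite linear_sum raddf_sum; apply: eq_bigr => b _.
by rewrite /= eulerX mevalZ mevalX.
Qed.

Let meval_laplacian_chi x : (euler_laplacian chi).@[x] =
  \sum_i \sum_b (mu b i)%:R ^+ 2 * \prod_k x k ^+ mu b k.
Proof.
rewrite (linear_sum (@euler_laplacian K r.+1)) raddf_sum exchange_big; apply: eq_bigr => b _ /=.
rewrite euler_laplacianX mevalZ mevalX -mulr_suml natr_sum; congr (_ * _).
by apply: eq_bigr => i _; rewrite -natrX.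
Qed.

Let sum_euler_chi x : \sum_i (euler i chi).@[x] = (mdeg (mu b0))%:R * chi.@[x].
Proof.
rewrite meval_chi mulr_sumr; under eq_bigr do rewrite meval_euler_chi.
rewrite exchange_big; apply: eq_bigr => b _ /=; rewrite -mulr_suml; congr (_ * _).
by rewrite -(mu_deg b) mdegE natr_sum.
Qed.

Lemma euler_laplacian_alternant (e : 'I_r.+1 -> nat) :
  euler_laplacian (alternant K e) = (\sum_i e i ^ 2)%:R *: alternant K e.
Proof.
rewrite alternantE (linear_sum (@euler_laplacian K r.+1)) scaler_sumr; apply: eq_bigr => s _ /=.
rewrite linearZ /= euler_laplacianX !scalerA mulrC; congr (_%:R * _ *: _).
by rewrite [RHS](reindex_inj (@perm_inj _ s)); apply: eq_bigr => i _; rewrite mnmE.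
Qed.

Let euler_A i x : (forall j k : 'I_r.+1, j != k -> x j != x k) ->
  (euler i A).@[x] = A.@[x] * \sum_(j | j != i) x i / (x i - x j).
Proof.
move=> xd; have [b Ab] := alternant_vandermonde K r.
rewrite /A Ab linearZ /= !mevalZ euler_vandermonde_meval //; ring.
Qed.

Let norm_rho := (\sum_i rho0 i ^ 2)%N.

(** The vector rho0 = (r, ..., 0) is the half sum of positive roots shifted by r/2 in each
    coordinate; the term r times the degree accounts for this shift next to the Casimir scalar. *)
Let l_norm : (\sum_i l i ^ 2)%:R = norm_rho%:R + (\sum_i (mu b0 i)%:R ^+ 2 +
     \sum_(i < r.+1) \sum_(j < r.+1 | (i < j)%N) ((mu b0 i)%:R - (mu b0 j)%:R)) +
     r%:R * (mdeg (mu b0))%:R :> K.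
Proof.
have countl (i : 'I_r.+1) : \sum_(j < r.+1 | (i < j)%N) 1 = (r - i)%:R :> K.
  rewrite (reindex_inj rev_ord_inj) /= -[in RHS]subSS -[(r.+1 - i.+1)%N]/(rev_ord i : nat).
  rewrite -[in RHS]sum_ltn_ord natr_sum big_mkcond; apply: eq_bigr => j _ /=.
  have -> : (i < r.+1 - j.+1)%N = (j < r.+1 - i.+1)%N by lia.
  by case: ltnP.
have countr (i : 'I_r.+1) : \sum_(j < r.+1 | (j < i)%N) 1 = i%:R :> K.
  rewrite -[in RHS]sum_ltn_ord natr_sum big_mkcond; apply: eq_bigr => j _ /=.
  by case: ltnP.
have -> : \sum_(i < r.+1) \sum_(j < r.+1 | (i < j)%N) ((mu b0 i)%:R - (mu b0 j)%:R) =
    \sum_(i < r.+1) (mu b0 i)%:R * ((r - i)%:R - i%:R) :> K.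
  under eq_bigr do rewrite sumrB.
  rewrite sumrB [X in _ - X](exchange_big_dep predT) //= -sumrB; apply: eq_bigr => i _.
  by rewrite mulrBr -countl -countr !mulr_sumr; congr (_ - _); apply: eq_bigr => j _; rewrite mulr1.
rewrite /norm_rho mdegE !natr_sum mulr_sumr -!big_split /=; apply: eq_bigr => i _.
rewrite /l /rho0 !natrX natrD; have -> : (i%:R : K) = r%:R - (r - i)%:R.
  have ir : (i <= r)%N by rewrite -ltnS.
  by rewrite natrB //; ring.
by ring.
Qed.

(** Meant for w_ij = x_i / (x_i - x_j). It converts the off-diagonal part of the trace formula into
    the logarithmic derivatives of A, that is, the cross term in the Laplacian of A * chi. *)
Let weight_identity (w : 'I_r.+1 -> 'I_r.+1 -> K) (c : 'I_r.+1 -> K) :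
  (forall i j, j != i -> w j i = 1 - w i j) ->
  \sum_i \sum_(j | j != i) w i j * (c i - c j) =
  (\sum_i c i * \sum_(j | j != i) w i j) *+ 2 - r%:R * \sum_i c i.
Proof.
move=> wC; under eq_bigr => i _ do (under eq_bigr => j _ do rewrite mulrBr); under eq_bigr do rewrite sumrB.
rewrite sumrB [X in _ - X](exchange_big_dep predT) //=.
have cardC (i : 'I_r.+1) : \sum_(j | j != i) 1 = r%:R :> K.
  by rewrite sumr_const cardC1 card_ord.
have -> : \sum_i \sum_(j | j != i) w i j * c i = \sum_i c i * \sum_(j | j != i) w i j.
  by apply: eq_bigr => i _; rewrite mulr_sumr; apply: eq_bigr => j _; rewrite mulrC.
suff -> : \sum_j \sum_(i | j != i) w i j * c j =
    r%:R * \sum_i c i - \sum_i c i * \sum_(j | j != i) w i j by rewrite mulr2n; ring.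
rewrite mulr_sumr -sumrB; apply: eq_bigr => i _; rewrite -(cardC i) mulr_suml mulr_sumr -sumrB.
apply: eq_big => [j|j ij]; first by rewrite eq_sym.
by rewrite wC 1?eq_sym //; ring.
Qed.

(** By the product rule, A contributes |rho0|^2; the cross term and the Laplacian of chi together
    are the Casimir scalar plus r times the degree. [l_norm] adds these up to |l|^2. *)
Let laplacian_eigen_meval x : (forall i, x i != 0) -> (forall i j, i != j -> x i != x j) ->
  (euler_laplacian (A * chi)).@[x] = (\sum_i l i ^ 2)%:R * (A * chi).@[x].
Proof.
move=> x0 xd; have meval_lapM p q : (euler_laplacian (p * q)).@[x] =
    (euler_laplacian p).@[x] * q.@[x] + (\sum_i (euler i p).@[x] * (euler i q).@[x]) *+ 2 +
    p.@[x] * (euler_laplacian q).@[x].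
  rewrite euler_laplacianM mevalD mevalD mevalMn; congr (_ + _ *+ 2 + _); try exact: mevalM.
  by rewrite raddf_sum; apply: eq_bigr => i _; exact: mevalM.
rewrite meval_lapM (mevalM x A chi) meval_laplacian_chi euler_laplacian_alternant -/A -/norm_rho mevalZ.
have -> : \sum_i (euler i A).@[x] * (euler i chi).@[x] =
    A.@[x] * \sum_i (euler i chi).@[x] * \sum_(j | j != i) x i / (x i - x j).
  by rewrite mulr_sumr; apply: eq_bigr => i _; rewrite euler_A //; ring.
have := mu_trace x0 xd; rewrite -meval_chi big_split /=.
have -> : \sum_i \sum_(j | j != i) x i / (x i - x j) * (\sum_b (mu b i)%:R * \prod_k x k ^+ mu b k
      - \sum_b (mu b j)%:R * \prod_k x k ^+ mu b k) =
    \sum_i \sum_(j | j != i) x i / (x i - x j) * ((euler i chi).@[x] - (euler j chi).@[x]).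
  by apply: eq_bigr => i _; apply: eq_bigr => j _; rewrite !meval_euler_chi.
rewrite (@weight_identity (fun i j => x i / (x i - x j)) (fun i => (euler i chi).@[x])); last first.
  move=> i j ji; have xij := xd _ _ ji; field.
  by rewrite !subr_eq0 xij eq_sym xij.
rewrite sum_euler_chi l_norm.
set c0 := (X in X * _ = _); set Q := (X in _ = X + _); set Y := \sum_i (_ * _) => trace.
rewrite -/Q -/c0; move: (norm_rho%:R : K) => R2.
move: c0 Q Y trace => c0 Q Y trace.
have -> : (R2 + c0 + r%:R * (mdeg (mu b0))%:R) * (A.@[x] * chi.@[x]) =
  A.@[x] * (R2 * chi.@[x] + c0 * chi.@[x] + r%:R * (mdeg (mu b0))%:R * chi.@[x]).
  by ring.
by rewrite trace; ring.
Qed.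

Let alternant_rho_neq0 : A != 0.
Proof.
apply/eqP => A0; have [b Ab] := alternant_vandermonde K r.
have : A.@[fun i : 'I_r.+1 => i%:R] = 0 by rewrite A0 meval0.
rewrite /A Ab mevalZ rmorph_prod => /eqP; rewrite mulf_eq0 signr_eq0 /= prodf_seq_eq0.
case/hasP => j _; rewrite rmorph_prod prodf_seq_eq0 => /hasP[k _ /andP[jk]].
by rewrite rmorphB /= !mevalXU subr_eq0 eqr_nat gtn_eqF.
Qed.

Let laplacian_eigen : euler_laplacian (A * chi) = (\sum_i l i ^ 2)%:R *: (A * chi).
Proof.
apply/eqP; rewrite -subr_eq0; set D := _ - _; suff /eqP : A * D = 0.
  by rewrite mulf_eq0 (negPf alternant_rho_neq0).
apply: mpoly_eq0_nonzero => x x0; rewrite mevalM.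
have [/forallP xd|] := boolP [forall i, forall j, (i != j) ==> (x i != x j)].
  rewrite mevalB mevalZ laplacian_eigen_meval ?subrr ?mulr0 // => i j ij.
  by have /forallP/(_ j)/implyP/(_ ij) := xd i.
case/forallPn => i /forallPn[j]; rewrite negb_imply negbK => /andP[ij /eqP xij].
suff -> : A.@[x] = 0 by rewrite mul0r.
rewrite meval_alternant -det_tr; apply: (determinant_alternate ij) => k.
by rewrite !mxE xij.
Qed.

Let norm_support m : (A * chi)@_m != 0 -> (\sum_i m i ^ 2 = \sum_i l i ^ 2)%N.
Proof.
move=> Am; have := congr1 (mcoeff m) laplacian_eigen.
rewrite mcoeff_euler_laplacian mcoeffZ => /(mulIf Am)/eqP.
by rewrite eqr_nat => /eqP.
Qed.

Let mcoeff_product m : (A * chi)@_m = \sum_(s : 'S_r.+1) \sum_b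
  (-1) ^+ s * ([multinom rho0 (s k) | k < r.+1] + mu b == m)%MM%:R.
Proof.
rewrite /A alternantE mulr_suml linear_sum; apply: eq_bigr => s _ /=.
rewrite /chi mulr_sumr linear_sum; apply: eq_bigr => b _ /=.
by rewrite -scalerAl mcoeffZ -mpolyXD mcoeffX.
Qed.

(** The two summands of the exponent are bounded separately, by rearrangement and by [mu_lt]; at
    least one bound is strict. *)
Let product_dominated (c : 'I_r.+1 -> int) (s : 'S_r.+1) b :
  (forall i j : 'I_r.+1, (i < j)%N -> c j < c i) -> (s != 1%g) || (b != b0) ->
  \sum_i c i * ([multinom rho0 (s k) | k < r.+1] + mu b)%MM i < \sum_i c i * (l i)%:Z.
Proof.
move=> cdec sb.
have rho_le (t : 'S_r.+1) : t != 1%g -> \sum_i c i * (rho0 (t i))%:Z < \sum_i c i * (rho0 i)%:Z.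
  move=> t1; rewrite -subr_gt0 -sumrB; apply: lt_le_trans (perm_rearrangement t1 cdec) _.
  apply: ler_sum => i _; rewrite -mulrBr.
  suff -> : (rho0 i)%:Z - (rho0 (t i))%:Z = (t i)%:Z - i%:Z by [].
  by rewrite /rho0; have := ltn_ord i; have := ltn_ord (t i); lia.
have -> : \sum_i c i * ([multinom rho0 (s k) | k < r.+1] + mu b)%MM i =
    \sum_i c i * (rho0 (s i))%:Z + \sum_i c i * (mu b i)%:Z.
  by rewrite -big_split; apply: eq_bigr => i _ /=; rewrite mnmDE mnmE PoszD mulrDr.
have -> : \sum_i c i * (l i)%:Z = \sum_i c i * (rho0 i)%:Z + \sum_i c i * (mu b0 i)%:Z.
  by rewrite -big_split; apply: eq_bigr => i _ /=; rewrite -mulrDr -PoszD addnC.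
have [s1|/rho_le lts] := eqVneq s 1%g; have [bb0|/(mu_lt cdec) ltb] := eqVneq b b0.
- by rewrite s1 bb0 !eqxx in sb.
- rewrite s1 ler_ltD //; under eq_bigr do rewrite perm1; exact: lexx.
- by rewrite bb0 ltr_leD.
by rewrite ltrD.
Qed.

Theorem weyl_alternant : A * chi = alternant K l.
Proof.
have l_strict (i j : 'I_r.+1) : (i < j)%N -> (l j < l i)%N.
  move=> ij; rewrite /l; have := mu_dominant (ltnW ij); have := ltn_ord j; lia.
apply/eqP; rewrite -subr_eq0; apply/eqP; apply: antisym_eq0 => [s|m m_strict].
  have chi_sym : msym s chi = chi.
    apply/eqP; rewrite -subr_eq0; apply/eqP/mpoly_eq0_nonzero => x x0.
    suff e : (msym s chi).@[x] = \sum_b \prod_i x (s i) ^+ mu b i.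
      by rewrite mevalB e mu_sym // meval_chi subrr.
    rewrite /chi (linear_sum (msym s)) raddf_sum; apply: eq_bigr => b _ /=.
    rewrite msymX mevalX (reindex_inj (@perm_inj _ s)) /=.
    by apply: eq_bigr => i _; rewrite mnmE permK.
  by rewrite msymB msymM !msym_alternant chi_sym scalerBr -scalerAl.
have c_strict (i j : 'I_r.+1) : (i < j)%N -> (l j + m j)%:Z < (l i + m i)%:Z.
  by move=> ij; rewrite ltz_nat; have := l_strict _ _ ij; have := m_strict _ _ ij; lia.
have perm_l (s : 'S_r.+1) : [multinom l (s k) | k < r.+1] = m -> s = 1%g.
  move=> sm; apply/eqP; apply: contraT => /perm_inversion[i [j [ij sij]]].
  by have := m_strict _ _ ij; rewrite -sm !mnmE ltnNge ltnW // l_strict.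
have perm1_eq : [multinom l ((1 : 'S_r.+1)%g k) | k < r.+1] = [multinom l k | k < r.+1].
  by apply/mnmP => k; rewrite !mnmE perm1.
have rho1_eq : ([multinom rho0 ((1 : 'S_r.+1)%g k) | k < r.+1] + mu b0 = [multinom l k | k < r.+1])%MM.
  by apply/mnmP => k; rewrite mnmDE !mnmE perm1 addnC.
(* Pairing this vector with l - m gives |l|^2 - |m|^2, which is 0 on the support of A * chi but
   positive by strict dominance. *)
pose c i := (l i + m i)%:Z.
have [ml|ml] := eqVneq m [multinom l k | k < r.+1].
  have dom (s : 'S_r.+1) b : (s != 1%g) || (b != b0) ->
      ([multinom rho0 (s k) | k < r.+1] + mu b == m)%MM = false.
    move=> sb; apply/negP => /eqP e; have := product_dominated c_strict sb.
    rewrite e; under eq_bigr => i _ do rewrite {2}ml mnmE.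
    by rewrite ltxx.
  rewrite mcoeffB mcoeff_alternant mcoeff_product (bigD1 1%g) //= (bigD1 b0) //=.
  rewrite rho1_eq -ml eqxx big1 => [|b bb0]; last by rewrite dom ?bb0 ?orbT // mulr0.
  rewrite big1 => [|s s1]; last by apply: big1 => b _; rewrite dom ?s1 // mulr0.
  rewrite (big_pred1 1%g) ?odd_perm1 ?mulr1 ?addr0 ?subrr // => s /=.
  by apply/eqP/eqP => [/perm_l //|->]; rewrite perm1_eq ml.
have -> : (A * chi - alternant K l)@_m = (A * chi)@_m.
  rewrite mcoeffB mcoeff_alternant big1 ?subr0 // => s /eqP sm.
  by move/eqP: ml; case; rewrite -sm (perm_l _ sm) perm1_eq.
apply/eqP; apply: contraT => Am; have norm_m := norm_support Am.
have /eqP : (A * chi)@_m = 0.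
  rewrite mcoeff_product big1 // => s _; apply: big1 => b _.
  case: eqP => [e|]; last by rewrite mulr0.
  have [sb|] := boolP ((s != 1%g) || (b != b0)); last first.
    rewrite negb_or !negbK => /andP[/eqP s1 /eqP bb0].
    by move/eqP: ml; case; rewrite -e s1 bb0 rho1_eq.
  have := product_dominated c_strict sb; rewrite e -subr_gt0 -sumrB.
  rewrite (eq_bigr (fun i => (l i ^ 2)%:Z - (m i ^ 2)%:Z)) => [|i _]; last first.
    by rewrite PoszD -!mulnn !PoszM; ring.
  by rewrite sumrB -!(big_morph Posz PoszD (erefl _)) -norm_m subrr ltxx.
by rewrite (negPf Am).
Qed.

End WeylAlternant.

(** * The character formula *)

Lemma prod_expz_shift (K : fieldType) n (z : 'I_n -> K) (e : 'I_n -> int) (N : int) :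
  \prod_i z i = 1 -> \prod_i z i ^ (e i + N) = \prod_i z i ^ e i.
Proof.
move=> z1; have z0 i : z i != 0.
  by apply/eqP => zi; move/eqP: z1; rewrite (bigD1 i) //= zi mul0r eq_sym oner_eq0.
under eq_bigr => i _ do rewrite expfzDr //.
rewrite big_split /= -[X in _ * X = _](big_morph (fun x : K => x ^ N) (fun x y => expfzMl x y N) (exp1rz _ N)).
by rewrite z1 exp1rz mulr1.
Qed.

Theorem weyl_character_torus (K : numClosedFieldType) r d (rho : 'M[K]_r.+1 -> 'M[K]_d)
    (lambda : 'I_r.+1 -> int) (z : 'rV[K]_r.+1) :
  SL_representation rho -> SL_irreducible rho -> has_highest_weight rho lambda ->
  dominant lambda -> \prod_i z 0 i = 1 ->
  \det (\matrix_(i < r.+1, k < r.+1) z 0 k ^ (lambda i + r%:Z - i%:Z)) =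
  \tr (rho (diag_mx z)) * \det (\matrix_(i < r.+1, k < r.+1) z 0 k ^+ (r - i)).
Proof.
move=> rho_rep rho_irr [v [v0 v_unip v_torus]] lambda_dom z1.
have [P rhoP] : exists P : 'I_d -> 'I_d -> {mpoly K[r.+1 * r.+1]}, forall i j g,
    in_SL g -> rho g i j = (P i j).@[fun k => mxvec g 0 k].
  have [_ _ reg] := rho_rep.
  by have [P Pi] := fin_all_exists (fun i => fin_all_exists (reg i)); exists P.
have [S [mu [b0 [S_unit S_torus [mu_b0 S_unip] mu_sum mu_lt]]]] :=
  highest_weight_basis rho_rep rhoP rho_irr v0 v_unip v_torus.
(* A bound for all weight entries: adding N makes every exponent non-negative without changing the
   characters where the product of the z_i is 1. *)
pose N := (\sum_b \sum_i `|mu b i|)%N.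
have N_ge b i : 0 <= mu b i + N%:Z.
  have : (`|mu b i| <= N)%N by rewrite /N (bigD1 b) //= (bigD1 i) //= -addnA leq_addr.
  lia.
pose m b := [multinom `|(mu b i + N%:Z)%R|%N | i < r.+1].
have mE b i : (m b i)%:Z = mu b i + N%:Z by rewrite mnmE gez0_abs.
have m_torus (y : 'rV[K]_r.+1) : \prod_i y 0 i = 1 ->
    rho (diag_mx y) *m S = S *m diag_mx (\row_b \prod_i y 0 i ^ (m b i)%:Z).
  move=> y1; rewrite S_torus //; congr (_ *m diag_mx _); apply/rowP => b; rewrite !mxE.
  by under [RHS]eq_bigr => i _ do rewrite mE; rewrite prod_expz_shift.
have m_sum b : \sum_i (m b i)%:Z = \sum_i (m b0 i)%:Z.
  by under eq_bigr do rewrite mE; under [RHS]eq_bigr do rewrite mE mu_b0; rewrite !big_split /= mu_sum.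
have m_deg b : mdeg (m b) = mdeg (m b0).
  by apply/eqP; rewrite !mdegE -eqz_nat !(big_morph Posz PoszD (erefl _)) m_sum.
(* An (r+1)-st root y of the product of the coordinates brings x into the torus of SL. All monomials
   have the same degree, so the power of y is common to all terms and cancels; the root exists
   because K is algebraically closed. *)
have scale (x : 'I_r.+1 -> K) : (forall i, x i != 0) -> exists y : K, 
    [/\ y != 0, \prod_i (\row_i (x i / y) : 'rV[K]_r.+1) 0 i = 1 &
      forall b (s : 'S_r.+1), \prod_i ((\row_i (x i / y) : 'rV[K]_r.+1) 0 (s i)) ^ (m b i)%:Z =
        (\prod_i x (s i) ^+ m b i) / y ^+ mdeg (m b0)].
  move=> x0; pose y := r.+1.-root (\prod_i x i); have yn : y ^+ r.+1 = \prod_i x i by rewrite rootCK.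
  have prod0 : \prod_i x i != 0 by apply/prodf_neq0.
  have y0 : y != 0 by apply: contraNneq prod0 => y0; rewrite -yn y0 expr0n.
  exists y; split=> // [|b s].
    under eq_bigr => i _ do rewrite mxE.
    by rewrite big_split /= prodr_const card_ord exprVn yn divff.
  rewrite -(m_deg b) mdegE -prodrXr -prodfV -big_split; apply: eq_bigr => i _ /=.
  by rewrite mxE -exprnP expr_div_n.
have scale1 (x : 'I_r.+1 -> K) y b : 
  \prod_i ((\row_i (x i / y) : 'rV[K]_r.+1) 0 i) ^ (m b i)%:Z =
  \prod_i ((\row_i (x i / y) : 'rV[K]_r.+1) 0 ((1 : 'S_r.+1)%g i)) ^ (m b i)%:Z.
  by apply: eq_bigr => i _; rewrite perm1.
have prod1 (x : 'I_r.+1 -> K) b : \prod_i x ((1 : 'S_r.+1)%g i) ^+ m b i = \prod_i x i ^+ m b i.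
  by apply: eq_bigr => i _; rewrite perm1.
have m_lt (c : 'I_r.+1 -> int) b : (forall i j : 'I_r.+1, (i < j)%N -> c j < c i) -> b != b0 ->
    \sum_i c i * (m b i)%:Z < \sum_i c i * (m b0 i)%:Z.
  move=> cdec bb0; under eq_bigr do rewrite mE mulrDr.
  under [X in _ < X]eq_bigr do rewrite mE mulrDr mu_b0.
  by rewrite !big_split /= ltrD2r mu_lt.
have m_dom (i j : 'I_r.+1) : (i <= j)%N -> (m b0 j <= m b0 i)%N.
  by move=> ij; rewrite -lez_nat !mE lerD2r !mu_b0 lambda_dom.
have m_sym (s : 'S_r.+1) (x : 'I_r.+1 -> K) : (forall i, x i != 0) ->
    \sum_b \prod_i x (s i) ^+ m b i = \sum_b \prod_i x i ^+ m b i.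
  move=> /scale[y [y0 xy1 xyE]]; have := mxtrace_torus_perm rho_rep S_unit m_torus s xy1.
  under eq_bigr => b _ do rewrite xyE.
  under [in RHS]eq_bigr => b _ do rewrite scale1 xyE prod1.
  by rewrite -!mulr_suml => /mulIf; apply; rewrite invr_eq0 expf_neq0.
have m_trace (x : 'I_r.+1 -> K) : (forall i, x i != 0) -> (forall i j, i != j -> x i != x j) ->
    (\sum_i (m b0 i)%:R ^+ 2 +
       \sum_(i < r.+1) \sum_(j < r.+1 | (i < j)%N) ((m b0 i)%:R - (m b0 j)%:R)) *
      \sum_b \prod_k x k ^+ m b k =
    \sum_i (\sum_b (m b i)%:R ^+ 2 * \prod_k x k ^+ m b k +
      \sum_(j | j != i) x i / (x i - x j) * (\sum_b (m b i)%:R * \prod_k x k ^+ m b k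
        - \sum_b (m b j)%:R * \prod_k x k ^+ m b k)).
  move=> x0 xd; have [y [y0 xy1 xyE]] := scale x x0.
  set D := y ^+ mdeg (m b0) in xyE; have D0 : D != 0 by rewrite expf_neq0.
  pose Z : 'rV[K]_r.+1 := \row_i (x i / y).
  have ZE b : \prod_k Z 0 k ^ (m b k)%:Z = \prod_k x k ^+ m b k / D.
    by rewrite scale1 xyE prod1.
  have Zd i j : i != j -> Z 0 i != Z 0 j.
    by move=> ij; rewrite !mxE (inj_eq (mulIf _)) ?invr_eq0 // xd.
  (* The shifted weight [m b0] takes the place of lambda here, so the identity acts by the sum of
     its entries. *)
  have := trace_formula rho_rep rhoP rho_irr S_unit m_torus (frefl _) S_unip m_sum xy1 Zd.
  have sumE (F : 'I_d -> K) : \sum_b F b * \prod_k Z 0 k ^ (m b k)%:Z =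
      (\sum_b F b * \prod_k x k ^+ m b k) / D.
    by rewrite mulr_suml; apply: eq_bigr => b _; rewrite ZE mulrA.
  have -> : \sum_b \prod_k Z 0 k ^ (m b k)%:Z = (\sum_b \prod_k x k ^+ m b k) / D.
    by rewrite mulr_suml; apply: eq_bigr => b _; rewrite ZE.
  rewrite mulrA => e; apply: (mulIf (_ : D^-1 != 0)); first by rewrite invr_eq0.
  rewrite [RHS]mulr_suml; apply: etrans (etrans e _).
    congr (_ * _ / _); rewrite rmorphD !rmorph_sum; congr (_ + _).
      by apply: eq_bigr => i _; rewrite rmorphXn.
    by apply: eq_bigr => i _; rewrite rmorph_sum; apply: eq_bigr => j _; rewrite rmorphB.
  apply: eq_bigr => i _; rewrite mulrDl; congr (_ + _).
    rewrite sumE; congr (_ / _); apply: eq_bigr => b _; by rewrite rmorphXn.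
  rewrite mulr_suml; apply: eq_bigr => j ji; rewrite !sumE -mulrBl mulrA; congr (_ * _ / _).
  have xij : x i - x j != 0 by rewrite subr_eq0 xd // eq_sym.
  by rewrite !mxE -mulrBl; field; rewrite xij y0.
have /(congr1 (fun p => p.@[fun i => z 0 i])) := weyl_alternant m_deg m_lt m_dom m_sym m_trace.
rewrite mevalM !meval_alternant raddf_sum /=.
under eq_bigr => b _ do rewrite mevalX.
rewrite mulrC (mxtrace_torus S_unit m_torus z1) => ->.
(* Undoes the shift by N: it multiplies column k of the alternant by z_k^N, and the product of these
   factors is 1. *)
pose zN : 'rV[K]_r.+1 := \row_k z 0 k ^ N%:Z.
rewrite -[LHS]mulr1; have <- : \det (diag_mx zN) = 1.
  rewrite det_diag; have := prod_expz_shift (fun=> 0) N z1; rewrite [RHS]big1 // => e.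
  by rewrite -[RHS]e; apply: eq_bigr => k _; rewrite mxE add0r.
rewrite -det_mulmx mul_mx_diag; congr (\det _); apply/matrixP => i k; rewrite !mxE.
have zk0 : z 0 k != 0.
  by apply/eqP => zk; move/eqP: z1; rewrite (bigD1 k) //= zk mul0r eq_sym oner_eq0.
rewrite -expfzDr // exprnP; congr (_ ^ _); rewrite PoszD mE mu_b0.
by have := ltn_ord i; lia.
Qed.

(** * Wedges of powers *)

Lemma wedgeE (K : fieldType) n k (A : 'I_k -> 'M[K]_n) e :
  wedge A e = \det (\matrix_(i, j) A i (e j).1 (e j).2).
Proof.
rewrite -det_tr /wedge sum_ffunE; apply: eq_bigr => s _; rewrite !ffunE.
by congr (_ * _); apply: eq_bigr => j _; rewrite !mxE.
Qed.

Lemma invmx_eq (K : fieldType) n (A B : 'M[K]_n) : A *m B = 1%:M -> invmx A = B.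
Proof.
move=> AB; have [Au _] := mulmx1_unit AB.
by have := congr1 (mulmx (invmx A)) AB; rewrite mulmxA mulVmx // mul1mx mulmx1.
Qed.

Lemma conj_diag_exprz (K : fieldType) r (Q : 'M[K]_r.+1) (z : 'rV[K]_r.+1) (l : int) :
  Q \in unitmx -> (forall i, z 0 i != 0) ->
  (Q *m diag_mx z *m invmx Q) ^ l = Q *m diag_mx (\row_i z 0 i ^ l) *m invmx Q.
Proof.
move=> Qu z0; have mulC (u w : 'rV[K]_r.+1) : (Q *m diag_mx u *m invmx Q) *m
    (Q *m diag_mx w *m invmx Q) = Q *m diag_mx (\row_i (u 0 i * w 0 i)) *m invmx Q.
  by rewrite -mulmx_diag !mulmxA mulmxKV.
have pos n : (Q *m diag_mx z *m invmx Q) ^+ n = Q *m diag_mx (\row_i z 0 i ^+ n) *m invmx Q.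
  elim: n => [|n IH].
    have -> : \row_i z 0 i ^+ 0 = const_mx 1 by apply/rowP => i; rewrite !mxE.
    by rewrite diag_const_mx mulmx1 mulmxV.
  rewrite exprS IH -mulmxE mulC; congr (_ *m diag_mx _ *m _).
  by apply/rowP => i; rewrite !mxE exprS.
case: l => n; first exact: pos.
rewrite NegzE -exprnN pos; apply: invmx_eq; rewrite mulC.
have -> : \row_i ((\row_i z 0 i ^+ n.+1) 0 i * (\row_i z 0 i ^ (- n.+1%:Z)) 0 i) = const_mx 1.
  by apply/rowP => i; rewrite !mxE -exprnN divff // expf_neq0.
by rewrite diag_const_mx mulmx1 mulmxV.
Qed.

(** The second determinant is a coordinate of the wedge of the spectral projectors. It does not
    involve [l], so it is common to both sides of the theorem. *)
Lemma wedge_conj_diag (K : fieldType) r (Q : 'M[K]_r.+1) (z : 'rV[K]_r.+1)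
    (l : 'I_r.+1 -> int) e : Q \in unitmx -> (forall i, z 0 i != 0) ->
  wedge (fun i => (Q *m diag_mx z *m invmx Q) ^ l i) e =
  \det (\matrix_(i, k) z 0 k ^ l i) *
    \det (\matrix_(k < r.+1, j < r.+1) (Q (e j).1 k * invmx Q k (e j).2)).
Proof.
move=> Qu z0; rewrite wedgeE -det_mulmx; congr (\det _); apply/matrixP => i j.
rewrite !mxE conj_diag_exprz // mul_mx_diag mxE; apply: eq_bigr => k _.
by rewrite !mxE; ring.
Qed.

Lemma trig_diagonalizable (K : fieldType) r (T : 'M[K]_r.+1) : is_trig_mx T ->
  injective (fun i => T i i) ->
  exists (Q : 'M[K]_r.+1) (z : 'rV[K]_r.+1), Q \in unitmx /\ T = Q *m diag_mx z *m invmx Q.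
Proof.
move=> Ttrig Tinj; have /diagonalizableP : exists2 rs, uniq rs & mxminpoly T %| \prod_(x <- rs) ('X - x%:P).
  exists [seq T i i | i <- enum 'I_r.+1]; first by rewrite map_inj_uniq ?enum_uniq.
  by rewrite big_map big_enum /= -char_poly_trig // mxminpoly_dvd_char.
case=> Q Qu /(diagonalizable_forLR Qu)[z ->]; exists (invmx Q), z.
by split; [rewrite unitmx_inv | rewrite invmxK mxpoly.conjVmx].
Qed.

(** * From the maximal torus to all of SL *)

Section WeylDiagonalizable.
Variables (K : numClosedFieldType) (r d : nat) (rho : 'M[K]_r.+1 -> 'M[K]_d).
Variable lambda : 'I_r.+1 -> int.
Hypothesis rho_rep : SL_representation rho.
Hypothesis rho_irr : SL_irreducible rho.
Hypothesis rho_hw : has_highest_weight rho lambda.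
Hypothesis lambda_dom : dominant lambda.

Lemma wedge_weyl_diagonalizable Q (z : 'rV[K]_r.+1) e : Q \in unitmx -> \prod_i z 0 i = 1 ->
  wedge (fun i => (Q *m diag_mx z *m invmx Q) ^ (lambda i + r%:Z - i%:Z)) e =
  \tr (rho (Q *m diag_mx z *m invmx Q)) *
    wedge (fun i : 'I_r.+1 => (Q *m diag_mx z *m invmx Q) ^+ (r - i)) e.
Proof.
move=> Qu z1; have z0 i : z 0 i != 0.
  by apply/eqP => zi; move/eqP: z1; rewrite (bigD1 i) //= zi mul0r eq_sym oner_eq0.
rewrite wedge_conj_diag // (wedge_conj_diag (fun i : 'I_r.+1 => (r - i)%N%:Z)) // mulrA.
rewrite (weyl_character_torus rho_rep rho_irr rho_hw) //; congr (_ * _ * _).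
have detQ : \det Q != 0 by rewrite -unitfE -unitmxE.
(* [rho] is multiplicative only on SL, so the diagonalizing matrix Q is rescaled to determinant 1
   before conjugation invariance of the trace is used. *)
pose w : 'rV[K]_r.+1 := \row_i (if i == ord0 then (\det Q)^-1 else 1).
have wE : \det (diag_mx w) = (\det Q)^-1.
  rewrite det_diag big_ord_recl big1 => [|i _]; last by rewrite mxE.
  by rewrite mxE eqxx mulr1.
pose Q' := Q *m diag_mx w.
have Q'SL : in_SL Q' by rewrite /in_SL det_mulmx wE divff.
have wu : diag_mx w \in unitmx by rewrite unitmxE wE unitrV -unitmxE.
have -> : Q *m diag_mx z *m invmx Q = Q' *m diag_mx z *m invmx Q'.
  have -> : invmx Q' = invmx (diag_mx w) *m invmx Q.
    by apply: invmx_eq; rewrite /Q' mulmxA mulmxK // mulmxV.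
  rewrite /Q' !mulmxA -[_ *m diag_mx w *m _]mulmxA.
  have -> : diag_mx w *m diag_mx z = diag_mx z *m diag_mx w.
    by rewrite !mulmx_diag; congr diag_mx; apply/rowP => i; rewrite !mxE mulrC.
  by rewrite !mulmxA mulmxK.
have zSL : in_SL (diag_mx z) by rewrite /in_SL det_diag.
have [_ rhoM _] := rho_rep; have rgV := repV rho_rep Q'SL.
have Q'iSL := in_SLV Q'SL; have Q'zSL := in_SLM Q'SL zSL.
by rewrite (rhoM _ _ Q'zSL Q'iSL) (rhoM _ _ Q'SL zSL) [RHS]mxtrace_mulC mulmxA (mulmx1C rgV) mul1mx.
Qed.

Lemma regular_exprz (c : K -> 'M[K]_r.+1) :
  (exists D, regular_mxder 'X c D) -> (exists D, regular_mxder 'X (fun a => invmx (c a)) D) ->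
  forall l : int, exists D, regular_mxder 'X (fun a => c a ^ l) D.
Proof.
have X1 := hornerX (1 : K).
have pos (b : K -> 'M[K]_r.+1) n : (exists D, regular_mxder 'X b D) ->
    exists D, regular_mxder 'X (fun a => b a ^+ n) D.
  move=> [D bD]; elim: n => [|n [E bE]].
    by exists 0; apply: (regular_mxder_ext X1) (regular_mxder_const X1 1) => a _; rewrite expr0.
  eexists; apply: (regular_mxder_ext X1) (regular_mxderM X1 bD bE) => a _.
  by rewrite exprS.
move=> cD ciD [] n; first exact: pos.
have [D ciD'] := pos _ n.+1 ciD; exists D; apply: (regular_mxder_ext X1) ciD' => a _.
by rewrite NegzE -exprnN -exprVn.
Qed.

Lemma wedge_regular (c : K -> 'M[K]_r.+1) (l : 'I_r.+1 -> int) e :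
  (forall l : int, exists D, regular_mxder 'X (fun a => c a ^ l) D) ->
  exists f', regular_der 'X (fun a => wedge (fun i => c a ^ l i) e) f'.
Proof.
move=> creg; have X1 := hornerX (1 : K).
have perm_reg (s : 'S_r.+1) : exists f', regular_der 'X
    (fun a => (-1) ^+ s * \prod_i (c a ^ l (s i)) (e i).1 (e i).2) f'.
  have [|f' f'E] := @regular_der_prod K 'X X1 _ (index_enum 'I_r.+1) predT
    (fun i a => (c a ^ l (s i)) (e i).1 (e i).2).
    by move=> i _; have [D cD] := creg (l (s i)); exists (D (e i).1 (e i).2).
  by eexists; apply: (regular_der_scale X1) f'E.
have [F FE] := fin_all_exists perm_reg.
have sum_reg := @regular_der_sum _ _ X1 _ (index_enum _) predT _ _ (fun s _ => FE s).
eexists; apply: (regular_der_ext X1) sum_reg => a _.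
by rewrite /wedge sum_ffunE; apply: eq_bigr => s _; rewrite !ffunE.
Qed.

Lemma wedge_weyl g e : in_SL g ->
  wedge (fun i => g ^ (lambda i + r%:Z - i%:Z)) e =
  \tr (rho g) * wedge (fun i : 'I_r.+1 => g ^+ (r - i)) e.
Proof.
move=> gSL; have X1 := hornerX (1 : K).
have [P Punitary] := @Schur K _ g (ltn0Sn r).
have Pu := unitarymx_unit Punitary.
rewrite /simmx_to_for => Ttrig; set T := mxpoly.conjmx P g in Ttrig.
have gT : g = invmx P *m T *m P by rewrite /T mxpoly.conjumx // !mulmxA mulVmx // mul1mx mulmxKV.
have {}Ttrig : is_trig_mx T by exact: Ttrig.
have TSL : \det T = 1.
  rewrite /T mxpoly.conjumx // !det_mulmx gSL mulr1 -det_mulmx mulmxV //; exact: det1.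
have detT : \prod_i T i i = 1 by rewrite -det_trig.
clearbody T; have T0 i : T i i != 0.
  by apply/eqP => Ti; move/eqP: detT; rewrite (bigD1 i) //= Ti mul0r eq_sym oner_eq0.
(* The exponents r - 2i are distinct with sum 0: multiplying the triangular form T by diag (a^(r -
   2i)) stays in SL and makes the diagonal entries distinct for generic a, with T itself at a =
   1. *)
pose ex (i : 'I_r.+1) : int := r%:Z - (i + i)%N%:Z.
have ex_sum : \sum_i ex i = 0.
  suff : \sum_i ex i = - \sum_i ex i by lia.
  rewrite {1}(reindex_inj rev_ord_inj) -sumrN; apply: eq_bigr => i _; rewrite /ex /=.
  by have := ltn_ord i; lia.
pose w (a : K) : 'rV[K]_r.+1 := \row_i a ^ ex i.
have w0 a : a != 0 -> \prod_i w a 0 i = 1.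
  move=> a0; under eq_bigr => i _ do rewrite mxE.
  by rewrite -(big_morph (fun n : int => a ^ n) (fun m n => expfzDr m n a0) (expr0z a)) ex_sum expr0z.
pose W a := diag_mx (w a); pose c a := invmx P *m (T *m W a) *m P.
have c1 : c 1 = g.
  rewrite /c gT; congr (_ *m _ *m _); rewrite -[RHS]mulmx1; congr (_ *m _).
  by rewrite -diag_const_mx; congr diag_mx; apply/rowP => i; rewrite !mxE exp1rz.
have cE a : c a = (invmx P *m T) *m W a *m P by rewrite /c !mulmxA.
have cD := regular_mxder_mulmx X1 (invmx P *m T) P (regular_diag_exprz K ex).
have ciD := regular_mxder_mulmx X1 (invmx P) (invmx T *m P) (regular_diag_exprz K (fun i => - ex i)).
have Tu : T \in unitmx by rewrite unitmxE TSL unitr1.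
have ciE a : a != 0 -> invmx (c a) =
    invmx P *m diag_mx (\row_i a ^ (- ex i)) *m (invmx T *m P).
  move=> a0; apply: invmx_eq; rewrite cE !mulmxA mulmxK // -[_ *m W a *m _]mulmxA.
  have -> : W a *m diag_mx (\row_i a ^ (- ex i)) = 1%:M.
    rewrite mulmx_diag -diag_const_mx; congr diag_mx; apply/rowP => i; rewrite !mxE.
    by rewrite -expfzDr // subrr expr0z.
  by rewrite mulmx1 mulmxK // mulVmx.
have creg : exists D, regular_mxder 'X c D.
  by eexists; apply: (regular_mxder_ext X1) cD => a _; rewrite cE.
have cireg : exists D, regular_mxder 'X (fun a => invmx (c a)) D.
  by eexists; apply: (regular_mxder_ext X1) ciD => a; rewrite hornerX => a0; rewrite ciE.
have cSL a : a != 0 -> in_SL (c a).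
  move=> a0; rewrite /in_SL cE !det_mulmx det_diag w0 // mulr1 TSL mulr1 -det_mulmx mulVmx //.
  exact: det1.
have [F1 F1E] := wedge_regular (fun i => lambda i + r%:Z - i%:Z) e (regular_exprz creg cireg).
have [F2 F2E] := wedge_regular (fun i : 'I_r.+1 => (r - i)%N%:Z) e (regular_exprz creg cireg).
have [F3 F3E] : exists F3, regular_der 'X (fun a => \tr (rho (c a))) F3.
  have [_ _ /(fun reg i => reg i i)/fin_all_exists[p pE]] := rho_rep.
  have [D cD'] := creg.
  have coord_reg k : regular_der 'X (fun a => mxvec (c a) 0 k) (mxvec D 0 k).
    case/mxvec_indexP: k => i j; rewrite mxvecE.
    by apply: (regular_der_ext X1) (cD' i j) => a _; rewrite mxvecE.
  have sum_reg := @regular_der_sum _ _ X1 _ (index_enum _) predT _ _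
    (fun i _ => regular_der_meval X1 (p i) coord_reg).
  eexists; apply: (regular_der_ext X1) sum_reg => a; rewrite hornerX => a0.
  by apply: eq_bigr => i _; rewrite pE //; apply: cSL.
have f_reg := regular_derD X1 F1E (regular_der_scale X1 (-1) (regular_derM X1 F3E F2E)).
(* The diagonal entries T_ii a^(r - 2i), multiplied by a^r, become the polynomials T_ii a^(2(r -
   i)); [s] is the product of their differences. *)
pose s : {poly K} := \prod_i \prod_(j | j != i)
  ((T i i)%:P * 'X^(2 * (r - i)) - (T j j)%:P * 'X^(2 * (r - j))).
have s0 : s != 0.
  apply/prodf_neq0 => i _; apply/prodf_neq0 => j ji.
  apply: contra_neq (T0 i) => /(congr1 (fun p : {poly K} => p`_(2 * (r - i)))).
  rewrite coefB !coefCM !coefXn coef0 eqxx mulr1.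
  suff -> : (2 * (r - i) == 2 * (r - j))%N = false by rewrite mulr0 subr0.
  apply/negP => /eqP e2; move/negP: ji; apply; apply/eqP/val_inj.
  by have := ltn_ord i; have := ltn_ord j; move: e2 => /=; lia.
suff : wedge (fun i => c 1 ^ (lambda i + r%:Z - i%:Z)) e +
    -1 * (\tr (rho (c 1)) * wedge (fun i : 'I_r.+1 => c 1 ^ (r - i)%N%:Z) e) = 0.
  by rewrite c1 mulN1r => /eqP; rewrite subr_eq0 => /eqP.
apply: (regular_der_generic0 X1 s0 _ f_reg) => a; rewrite hornerX => a0 sa.
have TWtrig : is_trig_mx (T *m W a).
  apply/is_trig_mxP => i j ij; rewrite mul_mx_diag mxE.
  by move/is_trig_mxP: Ttrig => ->; rewrite ?mul0r.
have TWinj : injective (fun i => (T *m W a) i i).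
  move=> i j; rewrite /W mul_mx_diag !mxE => eij; apply/eqP; apply: contraTT sa => ij.
  rewrite negbK horner_prod (bigD1 i) //= horner_prod (bigD1 j) 1?eq_sym //=.
  suff -> : ((T i i)%:P * 'X^(2 * (r - i)) - (T j j)%:P * 'X^(2 * (r - j))).[a] = 0.
    by rewrite !mul0r.
  rewrite hornerD hornerN !hornerM !hornerC !hornerXn.
  have pw (k : 'I_r.+1) : a ^+ (2 * (r - k)) = a ^ ex k * a ^ r%:Z.
    rewrite -expfzDr // exprnP; congr (_ ^ _); rewrite /ex; have := ltn_ord k; lia.
  by rewrite !pw !mulrA eij subrr.
have [Q [z [Qu TWE]]] := trig_diagonalizable TWtrig TWinj.
have PQu : invmx P *m Q \in unitmx by rewrite unitmx_mul unitmx_inv Pu.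
have caE : c a = (invmx P *m Q) *m diag_mx z *m invmx (invmx P *m Q).
  have -> : invmx (invmx P *m Q) = invmx Q *m P.
    by apply: invmx_eq; rewrite mulmxA mulmxK // mulVmx.
  by rewrite /c TWE !mulmxA.
have z1 : \prod_i z 0 i = 1.
  have := cSL a a0; rewrite caE; move: (invmx P *m Q) PQu => B Bu.
  rewrite /in_SL !det_mulmx det_diag mulrAC -det_mulmx mulmxV //.
  by rewrite det1 mul1r.
by rewrite mulN1r caE wedge_weyl_diagonalizable // subrr.
Qed.
End WeylDiagonalizable.

Theorem theorem2p1 (R : realType) (r : nat) (lambda : 'I_r.+1 -> int)
    (hlambda : dominant lambda)
    (chi : 'M[R[i]]_r.+1 -> R[i]) (hchi : is_irr_character lambda chi)
    (g : 'M[R[i]]_r.+1) (hg : in_SL g) :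
  wedge (fun i : 'I_r.+1 => g ^ ((lambda i + r%:Z - i%:Z))) =
  chi g *: wedge (fun i : 'I_r.+1 => g ^+ (r - i)%N).
Proof.
have [d [rho [rho_rep rho_irr rho_hw chiE]]] := hchi.
apply/ffunP => e; rewrite ffunE chiE //.
exact: wedge_weyl.
Qed.
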